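(* There is an absolute constant $C>0$ such that for every $n\ge1$ and all $\mathbf{u},\mathbf{v}\in\mathbb{S}^{n-1}$, $$d_{\mathrm{TV}}(\mathbb{P}_{\mathbf{u},\mathbf{v}},\mathbb{P}_{\mathbf{u},\mathbf{u}})\le C\,n\,\|\mathbf{u}-\mathbf{v}\|_2,$$ where, for $\mathcal{G}\sim\mathsf{GOTE}(4,n)$, $\mathbb{P}_{\mathbf{u},\mathbf{v}}$ denotes the joint law on $\mathbb{R}^{n(n+1)/2}$ of the entries (on and above the diagonal) of the symmetric matrix $\mathcal{G}\cdot\mathbf{u}\otimes\mathbf{v}$.
   Context: $\mathcal{G}\sim\mathsf{GOTE}(4,n)$ means that $\mathcal{G}=(\mathcal{G}_{i_1i_2i_3i_4})$ is a random symmetric tensor of order $4$ and dimension $n$ (invariant under permutations of indices in $[n]$) with density proportional to $\exp\big(-\frac18\|\mathcal{G}\|_F^2\big)$, $\|\mathcal{G}\|_F^2=\sum_{i_1,\dots,i_4\in[n]}\mathcal{G}_{i_1i_2i_3i_4}^2$, with respect to Lebesgue measure on the space of symmetric tensors. Equivalently, entries indexed by distinct multisets are independent and $\mathcal{G}_{i_1i_2i_3i_4}\sim\mathcal{N}(0,4/\#\mathrm{Perm}(i_1,\dots,i_4))$, where $\#\mathrm{Perm}$ is the number of distinct rearrangements. $\mathbb{S}^{n-1}$ is the unit sphere of $\mathbb{R}^n$. $\mathcal{G}\cdot\mathbf{u}\otimes\mathbf{v}$ is the $n\times n$ symmetric matrix with $(i,j)$ entry $\sum_{k,l}\mathcal{G}_{ijkl}u_kv_l$.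 $d_{\mathrm{TV}}$ is total variation distance. *)

(* Defs.v *)
From HB Require Import structures.
From mathcomp Require Import all_boot all_order all_algebra.
From mathcomp Require Import all_classical all_reals all_analysis.
From mathcomp Require Import measurable_realfun.

Set Implicit Arguments.
Unset Strict Implicit.
Unset Printing Implicit Defensive.

Import Order.TTheory GRing.Theory Num.Theory.
Import numFieldNormedType.Exports.

Local Open Scope classical_set_scope.
Local Open Scope ring_scope.

(* The library norm on 'rV[R]_n is the sup norm, hence this definition. *)
Definition norm2 (R : realType) (n : nat) (u : 'rV[R]_n) : R :=
  Num.sqrt (\sum_(i < n) u 0 i ^+ 2).

Definition unit_sphere (R : realType) (n : nat) : set 'rV[R]_n :=
  [set u | norm2 u = 1].

Definition d_TV d (T : measurableType d) (R : realType)
    (mu nu : probability T R) : \bar R :=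
  ereal_sup [set `|mu A - nu A|%E | A in measurable].

Definition mutually_independent d (T : measurableType d) (R : realType)
    (P : probability T R) (I : finType) (X : I -> {RV P >-> R}) : Prop :=
  forall (J : {set I}) (B : I -> set R),
    (forall i, measurable (B i)) ->
    P (\bigcap_(i in [set` J]) (X i @^-1` B i)) =
    (\prod_(i in J) P (X i @^-1` B i))%E.

(* Number of distinct rearrangements of a multi-index. *)
Definition nb_perm (n : nat) (s : 4.-tuple 'I_n) : nat :=
  #|[pred t : 4.-tuple 'I_n | perm_eq t s]|.

(* Nondecreasing multi-indices: one representative per multiset of size 4. *)
Definition sorted_index (n : nat) : finType :=
  {s : 4.-tuple 'I_n | sorted (fun i j : 'I_n => i <= j)%N s}.

(* normal_prob takes the standard deviation, the square root of the variance
   4 / nb_perm s. *)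
Definition is_GOTE4 d (T : measurableType d) (R : realType)
    (P : probability T R) (n : nat) (G : 4.-tuple 'I_n -> {RV P >-> R}) : Prop :=
  [/\ forall (s t : 4.-tuple 'I_n) (w : T), perm_eq s t -> G s w = G t w,
      mutually_independent (fun s : sorted_index n => G (sval s)) &
      forall (s : 4.-tuple 'I_n) (A : set R), measurable A ->
        distribution P (G s) A =
        normal_prob 0 (Num.sqrt (4 / (nb_perm s)%:R)) A].

(* The matrix written g . u (x) v in the mathematics. *)
Definition tensor_contract (R : realType) (n : nat) (g : 4.-tuple 'I_n -> R)
    (u v : 'rV[R]_n) : 'M[R]_n :=
  \matrix_(i, j) \sum_(k < n) \sum_(l < n)
    g [tuple i; j; k; l] * u 0 k * v 0 l.

Definition upper_index (n : nat) : finType :=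
  {p : 'I_n * 'I_n | (p.1 <= p.2)%N}.

Lemma card_upper_index (n : nat) : #|upper_index n| = (n * n.+1)./2.
Proof.
rewrite card_sig -sum1_card.
rewrite (eq_bigl (fun p : 'I_n * 'I_n => true && (p.1 <= p.2)%N)); last first.
  by move=> p; rewrite !inE.
rewrite -(pair_big_dep xpredT (fun i j : 'I_n => i <= j)%N (fun _ _ => 1%N)) /=.
rewrite (exchange_big_dep xpredT) //=.
rewrite (eq_bigr (fun j : 'I_n => j.+1)) => [|j _].
  by rewrite -[LHS]add0n -(big_ord_recl n (fun i => i : nat)) -(big_mkord xpredT id)
    bin2_sum bin2 mulnC.
by rewrite -(big_ord_widen n (fun _ => 1%N) (ltn_ord j)) sum1_card card_ord.
Qed.

(* The entries on and above the diagonal; tuples carry the product of the Borel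
   sigma-algebras. *)
Definition upper_entries (R : realType) (n : nat) (M : 'M[R]_n) :
    #|upper_index n|.-tuple (measurableTypeR R) :=
  [tuple M (sval (enum_val k)).1 (sval (enum_val k)).2
   | k < #|upper_index n|].

Definition contraction d (T : measurableType d) (R : realType)
    (P : probability T R) (n : nat) (G : 4.-tuple 'I_n -> {RV P >-> R})
    (u v : 'rV[R]_n) (w : T) : #|upper_index n|.-tuple (measurableTypeR R) :=
  upper_entries (tensor_contract (fun s => G s w) u v).

Lemma measurable_contraction d (T : measurableType d) (R : realType)
    (P : probability T R) (n : nat) (G : 4.-tuple 'I_n -> {RV P >-> R})
    (u v : 'rV[R]_n) :
  measurable_fun [set: T] (contraction G u v).
Proof.
apply/measurable_fun_tnthP => k.
rewrite (_ : _ \o _ = fun w => \sum_(a < n) \sum_(b < n)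
  G [tuple (sval (enum_val k)).1; (sval (enum_val k)).2; a; b] w
  * u 0 a * v 0 b); last first.
  by apply/funext => w; rewrite /= tnth_mktuple mxE.
apply: measurable_sum => a; apply: measurable_sum => b.
apply: measurable_funM; last exact: measurable_cst.
by apply: measurable_funM; last exact: measurable_cst.
Qed.

HB.instance Definition _ d (T : measurableType d) (R : realType)
    (P : probability T R) (n : nat) (G : 4.-tuple 'I_n -> {RV P >-> R})
    (u v : 'rV[R]_n) :=
  isMeasurableFun.Build _ _ _ _ (contraction G u v)
    (measurable_contraction G u v).

(* The law P_{u,v}. *)
Definition contraction_law d (T : measurableType d) (R : realType)
    (P : probability T R) (n : nat) (G : 4.-tuple 'I_n -> {RV P >-> R})
    (u v : 'rV[R]_n) :
    probability (#|upper_index n|.-tuple (measurableTypeR R)) R :=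
  distribution P (contraction G u v).

(* Main.v *)
From HB Require Import structures.
Require Import Defs.
From mathcomp Require Import all_boot all_order all_algebra.
From mathcomp Require Import all_classical all_reals all_analysis.
From mathcomp Require Import measurable_realfun ring lra.

(** Write w = v - u.  Contracting a symmetric tensor g with u, v gives its
    contraction with u, u plus the matrix m = g . (u (x) w).  There is an
    explicit symmetric tensor B(m) with B(m) . (u (x) u) = m
    ([lift_sym4], [lift_sym4_contract]), so
      g . (u (x) v) = (g + B(g . (u (x) w))) . (u (x) u):
    both laws are images, under one and the same map, of the Gaussian vector
    xi of normalized coordinates of the tensor and of its perturbation
    (I + E) xi, where E is the matrix of the linear map g |-> B(g . (u (x) w)).
    Images under a common map do not increase the total variation, hence it is
    enough to compare (I + E) xi with xi.

    Size of E.  The map B is bounded for Frobenius norms by an absolute constant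
    ([lift_sym4_norm]), and the squared Hilbert-Schmidt norm of
    g |-> g . (u (x) w) is at most the sum over i, j, k, l of u_k^2 w_l^2, that
    is n^2 |w|^2.  So the Hilbert-Schmidt norm |E| is at most 19 n |u - v|
    ([hs_sq_perturb_mx]); this is where the factor n comes from.

    Comparing (I + E) xi with xi ([gauss_add_lin_TV]).  The claim is that the
    total variation is at most 5 |E|.  It is trivial when |E| > 1/5.  Otherwise
    the change of variables
      mean of f(xi) = mean of f((I + E) xi) rho(xi),
      rho(x) = delta exp((|x|^2 - |x + E x|^2) / 2),  delta = det (I + E),
    shows that the two probabilities of an event differ by at most
    the mean of |rho(xi) - 1|, which is controlled by the relative entropy, the
    mean of - log rho(xi): a Pinsker inequality that here reduces to the pointwise
    bound [abs_sub1_le].  As xi . E xi has mean tr E and |E xi|^2 has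
    mean |E|^2, the entropy is - log delta + tr E + |E|^2 / 2, so everything rests on
    log delta >= tr E - 2 |E|^2.

    The change of variables and the bound on delta are proved together
    ([gauss_cov_add_lin]) by induction on the dimension.  One step of Gaussian
    elimination writes I + E as a shear after a map that is block triangular
    with respect to the first coordinate; both factors are handled by Fubini and
    the affine substitution on the line, and the Schur complement is again the
    identity plus a matrix whose norm has not increased ([schur_hs_bound]).  No
    determinant is ever formed.

    The moments of xi follow from the same change of variables ([gmean_quad_form]):
    Jensen applied to rho for the matrix t M, with t small of either sign,
    forces the mean of xi . M xi to be tr M. *)

Set Implicit Arguments.
Unset Strict Implicit.
Unset Printing Implicit Defensive.

Import Order.TTheory GRing.Theory Num.Theory.
Import numFieldNormedType.Exports.

Local Open Scope classical_set_scope.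
Local Open Scope ring_scope.

(** * Affine substitutions on the real line *)

Section OneDim.
Context {R : realType}.
Local Notation mu := (@lebesgue_measure R).
Implicit Types (a b : R) (h : R -> \bar R).

Definition affine a b : measurableTypeR R -> measurableTypeR R := fun x => a * x + b.

Lemma measurable_affine a b : measurable_fun setT (affine a b).
Proof. by apply: measurable_funD => //; apply: measurable_funM. Qed.

Let affine_image a b : {measure set (measurableTypeR R) -> \bar R} :=
  measure_function_pushforward__canonical__measure_function_Measure mu
    (measurable_affine a b).

(** The two sides are measures in A, so it suffices to compare them on half-open
    intervals. *)
Lemma lebesgue_measure_affine a b (A : set R) : 0 < a -> measurable A ->
  (a%:E * pushforward mu (affine a b) A = mu A)%E.
Proof.
move=> a0 mA; have ha : 0 <= a by exact: ltW.
pose nu : {measure set (measurableTypeR R) -> \bar R} :=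
  mscale (NngNum ha) (affine_image a b).
rewrite -[LHS]/(nu A).
apply/esym/lebesgue_measure_unique => //= _ [[x y]] _ <-.
rewrite /nu/= /mscale/= /pushforward/=.
have -> : affine a b @^-1` `]x, y]%classic = `](x - b) / a, (y - b) / a]%classic.
  apply/seteqP; split => z; rewrite /affine/= !in_itv/= ltr_pdivrMr// ler_pdivlMr//;
  by rewrite ltrBlDr lerBrDr mulrC.
rewrite !lebesgue_measure_itv/= !lte_fin ltr_pM2r ?invr_gt0// ltrD2r.
case: ifP => _; last by rewrite mule0.
rewrite -!EFinB -EFinM; congr (_%:E); field.
by rewrite gt_eqF.
Qed.

Lemma ge0_integral_affine a b h : 0 < a -> measurable_fun setT h ->
  (forall x, 0 <= h x)%E ->
  (\int[mu]_x (a%:E * h (a * x + b)%R) = \int[mu]_x h x)%E.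
Proof.
move=> a0 mh h0; have ha : 0 <= a by exact: ltW.
have mX := measurable_affine a b.
rewrite ge0_integralZl//=; last first.
  by apply: (@measurableT_comp _ _ _ _ _ _ h).
transitivity (a%:E * \int[pushforward mu (affine a b)]_x h x)%E.
  by rewrite ge0_integral_pushforward.
rewrite -(@ge0_integral_mscale _ _ _ (affine_image a b) setT measurableT (NngNum ha) h)//.
apply: eq_measure_integral => A mA _.
exact: lebesgue_measure_affine.
Qed.

(** The normal density and the Radon-Nikodym derivative with respect to the
    Lebesgue measure agree almost everywhere. *)
Lemma ge0_integral_normal m s h : measurable_fun setT h ->
  (forall x, 0 <= h x)%E ->
  (\int[normal_prob m s]_x h x = \int[mu]_x (h x * (normal_pdf m s x)%:E))%E.
Proof.
move=> mh h0; have dom := normal_prob_dominates m s.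
rewrite -(Radon_Nikodym_SigmaFinite.change_of_variables dom)//.
apply: ge0_ae_eq_integral => //.
- apply: emeasurable_funM => //.
  exact: (measurable_int _ (Radon_Nikodym_SigmaFinite.f_integrable dom)).
- apply: emeasurable_funM => //.
  by apply/measurable_EFinP; exact: measurable_normal_pdf.
- by move=> x _; rewrite mule_ge0 // Radon_Nikodym_SigmaFinite.f_ge0.
- by move=> x _; rewrite mule_ge0 // lee_fin normal_pdf_ge0.
- apply: ae_eqe_mul2l; apply: integral_ae_eq => //.
  + exact: Radon_Nikodym_SigmaFinite.f_integrable.
  + by apply/measurable_EFinP; exact: measurable_normal_pdf.
  + move=> A _ mA; rewrite -Radon_Nikodym_SigmaFinite.f_integral//.
Qed.

Definition stdnormal : probability (measurableTypeR R) R := normal_prob 0 1.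

Lemma normal_pdf01 x : normal_pdf 0 1 x = normal_peak 1 * expR (- (x ^+ 2) / 2) :> R.
Proof.
rewrite normal_pdfE ?oner_eq0// /normal_fun subr0 expr1n; congr (_ * expR (- _ / _)).
Qed.

(** The one-dimensional case of the change of variables: the weight is the
    Jacobian a times the ratio of the Gaussian densities at a x + b and at x. *)
Lemma stdnormal_affine a b h : 0 < a -> measurable_fun setT h ->
  (forall x, 0 <= h x)%E ->
  (\int[stdnormal]_x (h (a * x + b)%R *
     (a * expR ((x ^+ 2 - (a * x + b) ^+ 2) / 2))%:E)
   = \int[stdnormal]_x h x)%E.
Proof.
move=> a0 mh h0.
have mexp : measurable_fun setT
    (fun x : R => (a * expR ((x ^+ 2 - (a * x + b) ^+ 2) / 2))%:E).
  apply/measurable_EFinP; apply: measurable_funM => //.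
  apply: measurableT_comp => //; apply: measurable_funM => //.
  apply: measurable_funB; first exact: measurable_funX.
  by apply: measurable_funX; exact: measurable_affine.
have mha : measurable_fun setT (fun x : R => h (a * x + b)).
  by apply: (@measurableT_comp _ _ _ _ _ _ h) => //; exact: measurable_affine.
rewrite ge0_integral_normal; last 2 first.
- exact: emeasurable_funM.
- by move=> x; rewrite mule_ge0// lee_fin mulr_ge0 ?expR_ge0// ltW.
rewrite ge0_integral_normal// -[RHS](@ge0_integral_affine a b)//; last 2 first.
- apply: emeasurable_funM => //.
  by apply/measurable_EFinP; exact: measurable_normal_pdf.
- by move=> x; rewrite mule_ge0// lee_fin normal_pdf_ge0.
apply: eq_integral => x _; rewrite muleCA -muleA; congr (_ * _)%E.
rewrite !normal_pdf01 -!EFinM; congr (_%:E).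
set e1 := expR _; set e2 := expR _; set e3 := expR _.
have -> : e3 = e1 * e2 by rewrite /e1 /e2 /e3 -expRD; congr expR; lra.
ring.
Qed.

Lemma stdnormal_scale (s : R) (B : set R) : 0 < s -> measurable B ->
  normal_prob 0 s ((fun x => x / s) @^-1` B) = stdnormal B.
Proof.
move=> s0 mB; set B' := _ @^-1` B.
have mB' : measurable B'.
  rewrite -[X in measurable X]setTI.
  have : measurable_fun setT (fun x : R => x / s) by exact: measurable_funM.
  exact.
transitivity (\int[normal_prob 0 s]_x (\1_B' x)%:E)%E.
  by rewrite integral_indic// setIT.
transitivity (\int[stdnormal]_x (\1_B x)%:E)%E; last first.
  by rewrite integral_indic// setIT.
have mI (D : set R) : measurable D -> measurable_fun setT (fun x => (\1_D x)%:E : \bar R).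
  by move=> mD; apply/measurable_EFinP; exact: measurable_indic.
rewrite ge0_integral_normal; [|exact: mI|by move=> x; rewrite lee_fin].
rewrite [RHS]ge0_integral_normal; [|exact: mI|by move=> x; rewrite lee_fin].
rewrite -(@ge0_integral_affine s 0)//; last 2 first.
- apply: emeasurable_funM; apply/measurable_EFinP; first exact: measurable_indic.
  exact: measurable_normal_pdf.
- by move=> x; rewrite mule_ge0// lee_fin ?normal_pdf_ge0.
apply: eq_integral => x _; rewrite addr0 -!EFinM mulrCA; congr (_ * _)%:E.
  have EB : B' (s * x) = B x by rewrite /B'/= mulrAC divff ?gt_eqF// mul1r.
  by rewrite !indicE; congr (nat_of_bool _)%:R; apply/idP/idP; rewrite !inE EB.
rewrite !normal_pdfE ?oner_eq0 ?gt_eqF//.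
rewrite /normal_fun/normal_peak !subr0 expr1n mulrA; congr (_ * expR _).
  rewrite -!mulrnAr sqrtrM ?sqr_ge0// sqrtr_sqr gtr0_norm// mul1r invfM mulrA divff ?mul1r//.
  by rewrite gt_eqF.
by field; rewrite gt_eqF.
Qed.

End OneDim.

(** * The standard Gaussian vector and its changes of variables *)

Section Gauss.
Context {R : realType}.
Local Notation vec k := (k.-tuple (measurableTypeR R)).

Definition vcons k (p : measurableTypeR R * vec k) : vec k.+1 :=
  [the vec k.+1 of p.1 :: p.2].

Lemma measurable_vcons k : measurable_fun setT (@vcons k).
Proof. by apply: measurable_cons. Qed.

HB.instance Definition _ k :=
  isMeasurableFun.Build _ _ _ _ (@vcons k) (@measurable_vcons k).

(** The recursion on the first coordinate makes Fubini available at each step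
    of the inductions below. *)
Fixpoint gauss k : probability (vec k) R :=
  if k is k'.+1 then distribution (stdnormal \x gauss k')%E (@vcons k')
  else dirac [the vec 0 of [::]].

Lemma ge0_integral_gaussS k (f : vec k.+1 -> \bar R) :
  measurable_fun setT f -> (forall x, 0 <= f x)%E ->
  (\int[gauss k.+1]_z f z = \int[gauss k]_y \int[stdnormal]_x f (vcons (x, y)))%E.
Proof.
move=> mf f0; rewrite ge0_integral_distribution// fubini_tonelli2// => [|x]; last exact: f0.
exact: measurableT_comp.
Qed.

Lemma ge0_integral_gaussS' k (f : vec k.+1 -> \bar R) :
  measurable_fun setT f -> (forall x, 0 <= f x)%E ->
  (\int[gauss k.+1]_z f z = \int[stdnormal]_x \int[gauss k]_y f (vcons (x, y)))%E.
Proof.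
move=> mf f0; rewrite ge0_integral_distribution// fubini_tonelli1// => [|x]; last exact: f0.
exact: measurableT_comp.
Qed.

Definition sqn k (x : vec k) : R := \sum_(i < k) tnth x i ^+ 2.

Lemma sqn_vcons k (x : R) (y : vec k) : sqn (vcons (x, y)) = x ^+ 2 + sqn y.
Proof.
rewrite /sqn big_ord_recl/=; congr (_ + _).
by apply: eq_bigr => i _; rewrite tnthS.
Qed.

Lemma measurable_sqn k : measurable_fun setT (@sqn k).
Proof.
apply: measurable_sum => i; apply: measurable_funX.
exact: measurable_tnth.
Qed.

(** The ratio of the Gaussian densities at phi x and at x, times a constant
    delta that stands for the Jacobian determinant of phi. *)
Definition cov_weight k (delta : R) (phi : vec k -> vec k) x : R :=
  delta * expR ((sqn x - sqn (phi x)) / 2).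

Lemma cov_weight_gt0 k delta (phi : vec k -> vec k) x : 0 < delta -> 0 < cov_weight delta phi x.
Proof. by move=> d0; rewrite mulr_gt0// expR_gt0. Qed.

Lemma measurable_cov_weight k delta (phi : vec k -> vec k) :
  measurable_fun setT phi -> measurable_fun setT (cov_weight delta phi).
Proof.
move=> mphi; apply: measurable_funM => //; apply: measurableT_comp => //.
apply: measurable_funM => //; apply: measurable_funB; first exact: measurable_sqn.
by apply: measurableT_comp; first exact: measurable_sqn.
Qed.

(** The substitution phi has constant Jacobian delta, expressed through
    Gaussian integrals only. *)
Definition gauss_cov k (delta : R) (phi : vec k -> vec k) := [/\ 0 < delta,
  measurable_fun setT phi &
  forall f : vec k -> \bar R, measurable_fun setT f -> (forall x, 0 <= f x)%E ->
  (\int[gauss k]_x (f (phi x) * (cov_weight delta phi x)%:E) = \int[gauss k]_x f x)%E].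

(** The factors at the intermediate point psi x cancel. *)
Lemma gauss_cov_comp k d1 d2 (phi psi : vec k -> vec k) :
  gauss_cov d1 phi -> gauss_cov d2 psi -> gauss_cov (d1 * d2) (phi \o psi).
Proof.
move=> [d10 mphi cphi] [d20 mpsi cpsi]; split.
- exact: mulr_gt0.
- exact: measurableT_comp.
move=> f mf f0; rewrite -[RHS](cphi f mf f0) -[RHS]cpsi; last 2 first.
- apply: emeasurable_funM; first exact: measurableT_comp.
  by apply/measurable_EFinP; exact: measurable_cov_weight.
- by move=> x; rewrite mule_ge0// lee_fin ltW// cov_weight_gt0.
apply: eq_integral => x _; rewrite -muleA -EFinM; congr (_ * _%:E)%E.
rewrite /cov_weight/= mulrACA -expRD; congr (_ * expR _); lra.
Qed.

Definition vtail k (z : vec k.+1) : vec k := [tuple of behead z].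

Lemma vtail_vcons k p : vtail (@vcons k p) = p.2.
Proof. exact: val_inj. Qed.

Lemma thead_vcons k p : thead (@vcons k p) = p.1.
Proof. by []. Qed.

Lemma measurable_vtail k : measurable_fun setT (@vtail k).
Proof. exact: measurable_behead. Qed.

Lemma measurable_thead k : measurable_fun setT (@thead k _ : vec k.+1 -> _).
Proof. exact: measurable_tnth. Qed.

(** In terms of a vector (x, y) with first coordinate x, this is
    (x, y) |-> (a x + b(y), phi y). *)
Definition upper_map k a (b : vec k -> R) (phi : vec k -> vec k) (z : vec k.+1) :=
  vcons (a * thead z + b (vtail z), phi (vtail z)).

Lemma measurable_upper_map k a (b : vec k -> R) (phi : vec k -> vec k) :
  measurable_fun setT b -> measurable_fun setT phi ->
  measurable_fun setT (upper_map a b phi).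
Proof.
move=> mb mphi; apply: measurable_cons => /=.
  apply: measurable_funD; first by apply: measurable_funM => //; exact: measurable_thead.
  by apply: measurableT_comp => //; exact: measurable_vtail.
by apply: measurableT_comp => //; exact: measurable_vtail.
Qed.

(** At fixed y the first coordinate undergoes an affine substitution on the line;
    integrating it out first leaves the hypothesis on phi. *)
Lemma gauss_cov_upper k a delta (b : vec k -> R) (phi : vec k -> vec k) :
  0 < a -> measurable_fun setT b -> gauss_cov delta phi ->
  gauss_cov (a * delta) (upper_map a b phi).
Proof.
move=> a0 mb [d0 mphi cphi]; split.
- exact: mulr_gt0.
- exact: measurable_upper_map.
move=> f mf f0.
have ad0 : 0 < a * delta by exact: mulr_gt0.
pose g y := (\int[stdnormal]_x f (vcons (x, y)))%E.
have mfc : measurable_fun setT (f \o @vcons k) by exact: measurableT_comp.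
have mfy y : measurable_fun setT (fun x => f (vcons (x, y))).
  exact: (measurableT_comp mfc (@pair2_measurable _ _ _ _ y)).
have mg : measurable_fun setT g.
  by apply: (@measurable_fun_fubini_tonelli_G _ _ _ _ _ stdnormal (f \o @vcons k)) => // x; exact: f0.
have g0 y : (0 <= g y)%E by apply: integral_ge0 => x _; exact: f0.
rewrite (ge0_integral_gaussS mf f0) ge0_integral_gaussS; last 2 first.
- apply: emeasurable_funM; first by apply: measurableT_comp => //; exact: measurable_upper_map.
  by apply/measurable_EFinP; apply: measurable_cov_weight; exact: measurable_upper_map.
- by move=> x; rewrite mule_ge0// lee_fin ltW// cov_weight_gt0.
rewrite -/g -[RHS](cphi g mg g0); apply: eq_integral => y _.
have mjy : measurable_fun setT (fun x : R =>
    a * expR ((x ^+ 2 - (a * x + b y) ^+ 2) / 2)).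
  apply: measurable_funM => //; apply: measurableT_comp => //.
  apply: measurable_funM => //; apply: measurable_funB; first exact: measurable_funX.
  by apply: measurable_funX; exact: measurable_affine.
have -> : g (phi y) = (\int[stdnormal]_x (f (vcons ((a * x + b y)%R, phi y)) *
    (a * expR ((x ^+ 2 - (a * x + b y) ^+ 2) / 2))%R%:E))%E.
  by rewrite (stdnormal_affine (b y) a0 (mfy (phi y)) (fun x => f0 _)).
rewrite -ge0_integralZr; last 4 first.
- by [].
- apply: emeasurable_funM; last exact/measurable_EFinP.
  by apply: (measurableT_comp (mfy (phi y))); exact: measurable_affine.
- by move=> x _; rewrite mule_ge0// lee_fin mulr_ge0 ?expR_ge0// ltW.
- by rewrite lee_fin ltW// cov_weight_gt0.
apply: eq_integral => x _.
rewrite /upper_map thead_vcons vtail_vcons/= -muleA -EFinM; congr (_ * _%:E)%E.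
rewrite /cov_weight/= sqn_vcons/=.
rewrite thead_vcons vtail_vcons sqn_vcons/= mulrACA -expRD; congr (_ * expR _); lra.
Qed.

Definition translate k (c : 'I_k -> R) (y : vec k) : vec k :=
  [tuple tnth y i + c i | i < k].

Lemma gauss_cov_id k : gauss_cov 1 (@id (vec k)).
Proof.
split => [//|//|f _ _]; apply: eq_integral => x _.
by rewrite /cov_weight subrr mul0r expR0 mulr1 mule1.
Qed.

Lemma gauss_cov_translate k (c : 'I_k -> R) : gauss_cov 1 (translate c).
Proof.
elim: k c => [|k IH] c.
  rewrite (_ : translate c = id); first exact: gauss_cov_id.
  by apply/funext => x; rewrite [LHS]tuple0 [RHS]tuple0.
rewrite (_ : translate c =
    upper_map 1 (fun=> c ord0) (translate (fun i => c (lift ord0 i)))); last first.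
  apply/funext => z; apply: eq_from_tnth => i; rewrite tnth_mktuple.
  case: (unliftP ord0 i) => [j|] ->.
    by rewrite tnthS tnth_mktuple; congr (_ + _); rewrite {1}(tuple_eta z) tnthS.
  by rewrite tnth0 mul1r.
by rewrite -[X in gauss_cov X _]mulr1; apply: gauss_cov_upper.
Qed.

(** The shear (x, y) |-> (x, y + x c). *)
Definition lower_map k (c : 'I_k -> R) (z : vec k.+1) :=
  vcons (thead z, translate (fun i => thead z * c i) (vtail z)).

Lemma measurable_lower_map k (c : 'I_k -> R) : measurable_fun setT (lower_map c).
Proof.
apply: measurable_cons => /=; first exact: measurable_thead.
apply/measurable_fun_tnthP => i.
rewrite (_ : _ \o _ = fun z : vec k.+1 => tnth (vtail z) i + thead z * c i); last first.
  by apply/funext => z /=; rewrite tnth_mktuple.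
apply: measurable_funD; last by apply: measurable_funM => //; exact: measurable_thead.
by apply: (measurableT_comp (measurable_tnth i)); exact: measurable_vtail.
Qed.

(** At fixed x the remaining coordinates are translated. *)
Lemma gauss_cov_lower k (c : 'I_k -> R) : gauss_cov 1 (lower_map c).
Proof.
split; [exact: ltr01|exact: measurable_lower_map|move=> f mf f0].
have mfc : measurable_fun setT (f \o @vcons k) by exact: measurableT_comp.
have mfx x : measurable_fun setT (fun y => f (vcons (x, y))).
  exact: (measurableT_comp mfc (@pair1_measurable _ _ _ _ x)).
rewrite (ge0_integral_gaussS' mf f0) ge0_integral_gaussS'; last 2 first.
- apply: emeasurable_funM; first by apply: measurableT_comp => //; exact: measurable_lower_map.
  by apply/measurable_EFinP; apply: measurable_cov_weight; exact: measurable_lower_map.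
- by move=> x; rewrite mule_ge0// lee_fin ltW// cov_weight_gt0.
apply: eq_integral => x _.
have [_ _ ct] := gauss_cov_translate (fun i => x * c i).
rewrite -(ct _ (mfx x) (fun y => f0 _)).
apply: eq_integral => y _; rewrite /lower_map thead_vcons vtail_vcons/=.
congr (_ * _%:E)%E; rewrite /cov_weight !sqn_vcons/= thead_vcons vtail_vcons/=; congr (_ * expR _).
lra.
Qed.

End Gauss.

(** * Maps close to the identity *)

(** Lagrange's identity: twice the defect is the sum of the squares of
    x i * y j - x j * y i. *)
Lemma cauchy_schwarz (R : realDomainType) (I : finType) (x y : I -> R) :
  (\sum_i x i * y i) ^+ 2 <= (\sum_i x i ^+ 2) * (\sum_i y i ^+ 2).
Proof.
have : 0 <= \sum_i \sum_j (x i * y j - x j * y i) ^+ 2.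
  by apply: sumr_ge0 => i _; apply: sumr_ge0 => j _; exact: sqr_ge0.
set A := \sum_i x i ^+ 2; set B := \sum_i y i ^+ 2; set C := \sum_i x i * y i.
suff -> : \sum_i \sum_j (x i * y j - x j * y i) ^+ 2 = (A * B - C ^+ 2) *+ 2.
  by rewrite pmulrn_lge0// subr_ge0.
rewrite (eq_bigr (fun i => x i ^+ 2 * B + y i ^+ 2 * A - (x i * y i) * C *+ 2)) => [|i _].
  rewrite big_split/= big_split/= -!mulr_suml sumrN sumrMnl -mulr_suml -/A -/B -/C.
  by ring.
rewrite /A /B /C !mulr_sumr -sumrMnl -big_split/= -sumrB.
apply: eq_bigr => j _; ring.
Qed.

(** Elimination of the first row and column does not increase the
    Hilbert-Schmidt norm when it is at most 1/5.  Here a is the corner entry,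
    bb and cc the squared norms of the rest of the first row and column, d2 that
    of the remaining block D, S the inner product of D with the rank-one
    correction, and the left-hand side of the conclusion is the squared norm of
    the Schur complement D - kap c b.  The cross term is of order
    |D| |b| |c|, and the smallness of |D| lets r absorb it with room to spare:
    half of r is left over to pay for the error made on the trace. *)
Lemma schur_hs_bound (R : realFieldType) (a r d2 kap S bb cc : R) :
  a ^+ 2 + r + d2 <= 25^-1 -> kap * (1 + a) = 1 -> r = bb + cc -> 0 <= bb -> 0 <= cc ->
  0 <= d2 -> S ^+ 2 <= d2 * (cc * bb) ->
  d2 - 2 * kap * S + kap ^+ 2 * (cc * bb) <= d2 + r / 2.
Proof.
move=> h kE rE b0 c0 d0 hS.
have a2 : a ^+ 2 <= 25^-1 by nra.
have ha : - 5^-1 <= a <= 5^-1 by apply/andP; split; nra.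
have k0 : 0 <= kap <= 5 / 4 by apply/andP; split; nra.
have r1 : r <= 25^-1 by nra.
have Sr : - (r / 10) <= S <= r / 10.
  have : S ^+ 2 <= (r / 10) ^+ 2.
    apply: le_trans hS _; rewrite rE.
    have d1 : d2 <= 25^-1 by nra.
    have cb4 : cc * bb <= (bb + cc) ^+ 2 / 4 by have := sqr_ge0 (bb - cc); nra.
    have -> : ((bb + cc) / 10) ^+ 2 = 25^-1 * ((bb + cc) ^+ 2 / 4) by field.
    by apply: ler_pM => //; exact: mulr_ge0.
  have r0 : 0 <= r by lra.
  have q0 : 0 <= r / 10 by lra.
  by move=> hq; apply/andP; split; nra.
have : cc * bb <= r ^+ 2 / 4 by rewrite rE; have := sqr_ge0 (bb - cc); nra.
move=> cb; have cb' : cc * bb <= r / 100 by nra.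
have : kap ^+ 2 <= 25 / 16 by nra.
have : - (2 * kap * S) <= r / 4 by nra.
nra.
Qed.

Section NearId.
Context {R : realType}.
Local Notation vec k := (k.-tuple (measurableTypeR R)).

Implicit Type k : nat.
Definition hs_sq k (E : 'I_k -> 'I_k -> R) := \sum_i \sum_j E i j ^+ 2.
Definition mtr k (E : 'I_k -> 'I_k -> R) := \sum_i E i i.

Lemma hs_sq_ge0 k (E : 'I_k -> 'I_k -> R) : 0 <= hs_sq E.
Proof. by apply: sumr_ge0 => i _; apply: sumr_ge0 => j _; exact: sqr_ge0. Qed.

Definition add_lin k (E : 'I_k -> 'I_k -> R) (x : vec k) : vec k :=
  [tuple tnth x i + \sum_(j < k) E i j * tnth x j | i < k].

Definition dotr k (b : 'I_k -> R) (y : vec k) : R := \sum_j b j * tnth y j.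

Lemma measurable_dotr k (b : 'I_k -> R) : measurable_fun setT (dotr b).
Proof.
by apply: measurable_sum => i; apply: measurable_funM => //; exact: measurable_tnth.
Qed.

(** One step of Gaussian elimination. *)
Lemma schur_factor k (E : 'I_k.+1 -> 'I_k.+1 -> R) : 1 + E ord0 ord0 != 0 ->
  let a := E ord0 ord0 in
  let b j := E ord0 (lift ord0 j) in let c i := E (lift ord0 i) ord0 in
  add_lin E = lower_map (fun i => c i / (1 + a)) \o
    upper_map (1 + a) (dotr b)
     (add_lin (fun i j => E (lift ord0 i) (lift ord0 j) - c i / (1 + a) * b j)).
Proof.
move=> a0 a b c; rewrite -/a in a0.
apply/funext => z; apply: eq_from_tnth => i; rewrite [LHS]tnth_mktuple /=.
rewrite big_ord_recl.
have zt j : tnth z (lift ord0 j) = tnth (vtail z) j by rewrite {1}(tuple_eta z) tnthS.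
have S i' : \sum_(j < k) E i' (lift ord0 j) * tnth z (lift ord0 j) =
   dotr (fun j => E i' (lift ord0 j)) (vtail z).
  by apply: eq_bigr => j _; rewrite zt.
rewrite S; case: (unliftP ord0 i) => [j|] ->.
  rewrite tnthS tnth_mktuple /upper_map vtail_vcons thead_vcons/= tnth_mktuple.
  rewrite zt -/(c j) -addrA; congr (_ + _).
  rewrite (_ : \sum_(_ < k) _ = dotr (fun j0 => E (lift ord0 j) (lift ord0 j0)) (vtail z)
       - c j / (1 + a) * dotr b (vtail z)).
    rewrite -[tnth z ord0]/(thead z); field; exact: a0.
  rewrite /dotr mulr_sumr -sumrB; apply: eq_bigr => l _; ring.
by rewrite tnth0 /= thead_vcons -[tnth z ord0]/(thead z) -/a -/(dotr b _)/=; ring.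
Qed.

Lemma expR_le1D (a : R) : -2^-1 <= a -> expR (a - 2 * a ^+ 2) <= 1 + a.
Proof.
move=> ha; have a1 : 0 < 1 + a by lra.
(* The tangent line of the inverse exponential gives an upper bound. *)
have := expR_ge1Dx (- (a - 2 * a ^+ 2)); rewrite expRN => h.
have e0 : 0 < expR (a - 2 * a ^+ 2) by exact: expR_gt0.
move: h; set e := expR _ in e0 *; move=> h.
have h' : (1 - a + 2 * a ^+ 2) * e <= 1.
  by rewrite -ler_pdivlMr// mul1r; lra.
rewrite -(@ler_pM2r _ (1 - a + 2 * a ^+ 2)); last by nra.
apply: (@le_trans _ _ 1); first by rewrite mulrC.
by nra.
Qed.

(** Induction on the dimension by Gaussian elimination.  The constant is the
    product of the pivots 1 + a; each pivot is at least exp (a - 2 a^2), the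
    trace changes by the scalar product of first row and column divided by the
    pivot, and both losses are paid by the decrease of the squared norm from E
    to its Schur complement. *)
Theorem gauss_cov_add_lin k (E : 'I_k -> 'I_k -> R) : hs_sq E <= 25^-1 ->
  exists2 delta, gauss_cov delta (add_lin E) & expR (mtr E - 2 * hs_sq E) <= delta.
Proof.
elim: k E => [|k IH] E hE.
  exists 1.
    rewrite (_ : add_lin E = id); first exact: gauss_cov_id.
    by apply/funext => x; rewrite [LHS]tuple0 [RHS]tuple0.
  by rewrite /mtr /hs_sq !big_ord0 mulr0 subrr expR0.
pose a := E ord0 ord0; pose b j := E ord0 (lift ord0 j).
pose c i := E (lift ord0 i) ord0; pose D i j := E (lift ord0 i) (lift ord0 j).
pose kap := (1 + a)^-1.
pose D' i j := D i j - c i / (1 + a) * b j.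
pose bb := \sum_j b j ^+ 2; pose cc := \sum_i c i ^+ 2.
have bb0 : 0 <= bb by apply: sumr_ge0 => *; exact: sqr_ge0.
have cc0 : 0 <= cc by apply: sumr_ge0 => *; exact: sqr_ge0.
have hsE : hs_sq E = a ^+ 2 + (bb + cc) + hs_sq D.
  rewrite /hs_sq big_ord_recl big_ord_recl/= -/a -/bb.
  rewrite (eq_bigr (fun i => c i ^+ 2 + \sum_j D i j ^+ 2)) => [|i _]; last first.
    by rewrite big_ord_recl.
  rewrite big_split/= -/cc; ring.
have trE : mtr E = a + mtr D by rewrite /mtr big_ord_recl.
have D0 := hs_sq_ge0 D.
have ha : - 5^-1 <= a <= 5^-1.
  rewrite hsE in hE; have : a ^+ 2 <= 25^-1 by lra.
  by move=> ?; apply/andP; split; nra.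
have a0 : 1 + a != 0 by apply: lt0r_neq0; lra.
pose S := \sum_i \sum_j D i j * (c i * b j).
have ccbb : cc * bb = \sum_i \sum_j c i ^+ 2 * b j ^+ 2.
  by rewrite /cc mulr_suml; apply: eq_bigr => i _; rewrite mulr_sumr.
have hsD' : hs_sq D' = hs_sq D - 2 * kap * S + kap ^+ 2 * (cc * bb).
  rewrite ccbb /hs_sq /S !mulr_sumr -sumrB -big_split/=.
  apply: eq_bigr => i _; rewrite !mulr_sumr -sumrB -big_split/=.
  by apply: eq_bigr => j _; rewrite /D' /kap; ring.
have hS : S ^+ 2 <= hs_sq D * (cc * bb).
  rewrite ccbb /S /hs_sq !pair_bigA/=; apply: le_trans (cauchy_schwarz _ _) _.
  rewrite le_eqVlt; apply/orP; left; apply/eqP; congr (_ * _).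
  by apply: eq_bigr => p _; rewrite exprMn.
have trD' : mtr D' = mtr D - kap * \sum_i c i * b i.
  rewrite /mtr mulr_sumr -sumrB; apply: eq_bigr => i _; rewrite /D' /kap; ring.
have kapE : kap * (1 + a) = 1 by rewrite mulVf.
have hsD'le : hs_sq D' <= hs_sq D + (bb + cc) / 2.
  by rewrite hsD'; apply: (@schur_hs_bound _ a (bb + cc)) => //; rewrite -hsE.
have [|delta cd ed] := IH D'; first by rewrite hsE in hE; nra.
exists (1 * ((1 + a) * delta)).
  rewrite schur_factor//; apply: gauss_cov_comp; first exact: gauss_cov_lower.
  apply: gauss_cov_upper => //; last exact: measurable_dotr.
  by rewrite lt_neqAle eq_sym a0/=; lra.
rewrite mul1r; apply: (@le_trans _ _ (expR (a - 2 * a ^+ 2) * expR (mtr D' - 2 * hs_sq D'))).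
  rewrite -expRD ler_expR hsE trE trD'.
  have : kap * \sum_i c i * b i <= 5 / 8 * (bb + cc).
    rewrite /bb /cc -big_split/= !mulr_sumr; apply: ler_sum => i _.
    have hk : 0 <= kap <= 5 / 4.
      rewrite invr_ge0 -[_ / _]invrK invf_div lef_pV2 ?posrE; lra.
    have : 0 <= (c i - b i) ^+ 2 by exact: sqr_ge0.
    have : 0 <= (c i + b i) ^+ 2 by exact: sqr_ge0.
    by move: hk => /andP[k1 k2]; nra.
  by move: hsD'le; lra.
apply: ler_pM; rewrite ?expR_ge0//; apply: expR_le1D; lra.
Qed.
End NearId.

(** * Total variation between a Gaussian vector and its image *)

(** A linear function that is dominated near 0, on both sides, by a quadratic
    one vanishes: take t = d / c with c large. *)
Lemma lin_quad_le (R : realFieldType) (d K t0 : R) : 0 < t0 -> (forall t, `|t| <= t0 -> t * d <= t ^+ 2 * K) -> d = 0.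
Proof.
move=> t00 h; apply/eqP; apply/negPn/negP => d0.
have nd : 0 < `|d| by rewrite normr_gt0.
(* Any c > K with |d| <= c t0 would do. *)
pose c := `|K| + 1 + `|d| / t0.
have dt : 0 < `|d| / t0 by rewrite divr_gt0.
have c0 : 0 < c by rewrite addr_gt0 ?ltr_wpDl.
have ct : `|d / c| <= t0.
  rewrite normrM normfV (gtr0_norm c0) ler_pdivrMr// /c mulrDr [t0 * (_ / _)]mulrC.
  by rewrite divfK ?gt_eqF// lerDr mulr_ge0 ?ltW// ltr_wpDl.
have dK : d ^+ 2 * c <= d ^+ 2 * K.
  have c2 : 0 < c ^+ 2 by rewrite exprn_gt0.
  have := h _ ct; rewrite -(ler_pM2r c2).
  have -> : d / c * d * c ^+ 2 = d ^+ 2 * c by field; rewrite gt_eqF.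
  by have -> : (d / c) ^+ 2 * K * c ^+ 2 = d ^+ 2 * K by field; rewrite gt_eqF.
move: dK; rewrite ler_pM2l ?exprn_even_gt0//; apply/negP; rewrite -ltNge /c -addrA.
by apply: le_lt_trans (ler_norm _) _; rewrite ltrDl addr_gt0.
Qed.

(** With y the square root of rho, expR (l / 2) <= y gives
    (y - 1)^2 <= rho - 1 - l, and |rho - 1| = |y - 1| (y + 1) is split by the
    inequality of arithmetic and geometric means with weight s.  Integrated
    against the Gaussian it plays the part of Pinsker's inequality. *)
Lemma abs_sub1_le (R : realType) (rho l s : R) : 0 < s -> expR l <= rho ->
  `|rho - 1| <= (2 * s)^-1 * (rho - 1 - l) + s * (rho + 1).
Proof.
move=> s0 hl; have rho0 : 0 < rho by apply: lt_le_trans hl; exact: expR_gt0.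
pose y := Num.sqrt rho.
have y0 : 0 < y by rewrite sqrtr_gt0.
have yE : rho = y ^+ 2 by rewrite sqr_sqrtr// ltW.
have yl : 1 + l / 2 <= y.
  apply: le_trans (expR_ge1Dx _) _.
  rewrite -(ler_pXn2r (_ : 0 < 2)%N) ?nnegrE ?expR_ge0 ?(ltW y0)//.
  rewrite -yE (_ : expR (l / 2) ^+ 2 = expR l)//.
  by rewrite expr2 -expRD; congr expR; lra.
have -> : rho - 1 = (y - 1) * (y + 1) by rewrite yE; ring.
rewrite normrM (gtr0_norm (_ : 0 < y + 1)); last lra.
have h1 : (y - 1) ^+ 2 <= (y - 1) * (y + 1) - l by nra.
have h2 : (y + 1) ^+ 2 <= 2 * (rho + 1) by rewrite yE; have := sqr_ge0 (y - 1); nra.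
have s2 : 0 < (2 * s)^-1 by rewrite invr_gt0; lra.
apply: (@le_trans _ _ ((2 * s)^-1 * `|y - 1| ^+ 2 + s / 2 * (y + 1) ^+ 2)).
  rewrite -subr_ge0.
  rewrite (_ : _ - _ = (2 * s)^-1 * (`|y - 1| - s * (y + 1)) ^+ 2); last by field; lra.
  by rewrite mulr_ge0// ?sqr_ge0// ltW.
rewrite real_normK ?num_real//; apply: lerD; first by rewrite ler_pM2l.
by rewrite -mulrA ler_pM2l//; lra.
Qed.

Section TV.
Context {R : realType}.
Local Notation vec k := (k.-tuple (measurableTypeR R)).
Implicit Type k : nat.

Definition gintegrable k (f : vec k -> R) := (gauss k).-integrable setT (EFin \o f).
Definition gmean k (f : vec k -> R) : R := (\int[gauss k]_x f x)%R.

Lemma gintegrableD k (f g : vec k -> R) : gintegrable f -> gintegrable g -> gintegrable (fun x => f x + g x).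
Proof. by move=> hf hg; apply: eq_integrable (integrableD measurableT hf hg). Qed.

Lemma gintegrableZ k r (f : vec k -> R) : gintegrable f -> gintegrable (fun x => r * f x).
Proof. by move=> hf; apply: eq_integrable (integrableZl measurableT r hf). Qed.

Lemma gintegrableB k (f g : vec k -> R) : gintegrable f -> gintegrable g -> gintegrable (fun x => f x - g x).
Proof. by move=> hf hg; apply: eq_integrable (integrableB measurableT hf hg). Qed.

Lemma gintegrable_cst k r : gintegrable (fun _ : vec k => r).
Proof. exact: finite_measure_integrable_cst. Qed.

Lemma gintegrable_sum k (I : finType) (f : I -> vec k -> R) : (forall i, gintegrable (f i)) ->
  gintegrable (fun x => \sum_i f i x).
Proof.
move=> hf; apply: eq_integrable (integrable_sum measurableT (index_enum I) (fun i _ => hf i)) => //.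
by move=> x _ /=; rewrite sumEFin.
Qed.

Lemma gmean_cst k r : gmean (fun _ : vec k => r) = r.
Proof.
rewrite /gmean Rintegral_cst//; transitivity (r * fine (1%E : \bar R)); last by rewrite mulr1.
by congr (_ * fine _); exact: probability_setT.
Qed.

Lemma gmeanD k (f g : vec k -> R) : gintegrable f -> gintegrable g -> gmean (fun x => f x + g x) = gmean f + gmean g.
Proof. exact: RintegralD. Qed.
Lemma gmeanB k (f g : vec k -> R) : gintegrable f -> gintegrable g -> gmean (fun x => f x - g x) = gmean f - gmean g.
Proof. exact: RintegralB. Qed.
Lemma gmeanZ k r (f : vec k -> R) : gintegrable f -> gmean (fun x => r * f x) = r * gmean f.
Proof. exact: RintegralZl. Qed.
Lemma gmean_le k (f g : vec k -> R) : gintegrable f -> gintegrable g -> (forall x, f x <= g x) -> gmean f <= gmean g.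
Proof. by move=> hf hg fg; apply: le_Rintegral. Qed.

Lemma gintegrable_le k (f g : vec k -> R) : measurable_fun setT f ->
  (forall x, `|f x| <= g x) -> gintegrable g -> gintegrable f.
Proof.
move=> mf fg; apply: le_integrable => //; first exact/measurable_EFinP.
by move=> x _; rewrite /= lee_fin (le_trans (fg x))// ler_norm.
Qed.

Lemma integral_cov_weight k delta (phi : vec k -> vec k) : gauss_cov delta phi ->
  (\int[gauss k]_x (cov_weight delta phi x)%:E = 1)%E.
Proof.
move=> [_ _ /(_ (cst 1%E))]; under eq_integral do rewrite mul1e.
by move=> ->//; rewrite integral_cst// mul1e; exact: probability_setT.
Qed.

Lemma gintegrable_cov_weight k delta (phi : vec k -> vec k) : gauss_cov delta phi ->
  gintegrable (cov_weight delta phi).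
Proof.
move=> hc; have [d0 mphi _] := hc; apply/integrableP; split.
  by apply/measurable_EFinP; exact: measurable_cov_weight.
under eq_integral do rewrite gee0_abs ?lee_fin ?ltW ?cov_weight_gt0//.
by rewrite integral_cov_weight// ltry.
Qed.

Lemma gmean_cov_weight k delta (phi : vec k -> vec k) : gauss_cov delta phi ->
  gmean (cov_weight delta phi) = 1.
Proof. by move=> hc; rewrite /gmean /Rintegral integral_cov_weight. Qed.

Definition quad_form k (M : 'I_k -> 'I_k -> R) (x : vec k) : R :=
  \sum_i \sum_j M i j * (tnth x i * tnth x j).

Definition gram k (M : 'I_k -> 'I_k -> R) i j : R := \sum_l M l i * M l j.

Lemma mtr_gram k (M : 'I_k -> 'I_k -> R) : mtr (gram M) = hs_sq M.
Proof.
rewrite /mtr /gram /hs_sq exchange_big/=; apply: eq_bigr => i _.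
by apply: eq_bigr => j _; rewrite expr2.
Qed.

Lemma sqn_add_lin k (M : 'I_k -> 'I_k -> R) x :
  sqn (add_lin M x) = sqn x + 2 * quad_form M x + quad_form (gram M) x.
Proof.
have -> : quad_form (gram M) x = \sum_i (\sum_j M i j * tnth x j) ^+ 2.
  rewrite /quad_form /gram.
  rewrite (eq_bigr (fun i => \sum_l \sum_j M l i * M l j * (tnth x i * tnth x j))); last first.
    by move=> i _; rewrite exchange_big/=; apply: eq_bigr => j _; rewrite mulr_suml.
  rewrite exchange_big/=; apply: eq_bigr => l _.
  rewrite expr2 mulr_suml; apply: eq_bigr => i _; rewrite mulr_sumr.
  by apply: eq_bigr => j _; ring.
rewrite /sqn /quad_form mulr_sumr -!big_split/=; apply: eq_bigr => i _.
rewrite tnth_mktuple.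
rewrite (_ : \sum_(j < k) M i j * (tnth x i * tnth x j) = tnth x i * \sum_(j < k) M i j * tnth x j); last first.
  by rewrite mulr_sumr; apply: eq_bigr => j _; ring.
ring.
Qed.

Lemma quad_formZ k t (M : 'I_k -> 'I_k -> R) x : quad_form (fun i j => t * M i j) x = t * quad_form M x.
Proof.
rewrite /quad_form mulr_sumr; apply: eq_bigr => i _; rewrite mulr_sumr.
by apply: eq_bigr => j _; ring.
Qed.

Lemma hs_sqZ k t (M : 'I_k -> 'I_k -> R) : hs_sq (fun i j => t * M i j) = t ^+ 2 * hs_sq M.
Proof.
rewrite /hs_sq mulr_sumr; apply: eq_bigr => i _; rewrite mulr_sumr.
by apply: eq_bigr => j _; rewrite exprMn.
Qed.

Lemma mtrZ k t (M : 'I_k -> 'I_k -> R) : mtr (fun i j => t * M i j) = t * mtr M.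
Proof. by rewrite /mtr mulr_sumr. Qed.

(** For the contraction x |-> (1 - t) x the weight is a constant times
    exp (c |x|^2) with c > 0.  It is integrable, and it dominates |x|^2. *)
Lemma gintegrable_sqn k : gintegrable (@sqn R k).
Proof.
(* With this t the matrix - t I has squared norm k t^2 <= 1/25. *)
pose t : R := (5 * k.+1%:R)^-1.
have k0 : 0 < k.+1%:R :> R by rewrite ltr0n.
have k1 : 1 <= k.+1%:R :> R by rewrite ler1n.
have t0 : 0 < t by rewrite invr_gt0 mulr_gt0.
have tE : t * k.+1%:R = 5^-1 by rewrite /t; field; lra.
have t1 : t <= 5^-1 by rewrite -tE; nra.
pose E i j : R := - t * (i == j :> 'I_k)%:R.
have hE : hs_sq E <= 25^-1.
  rewrite hs_sqZ /hs_sq (eq_bigr (fun=> 1)) => [|i _]; last first.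
    rewrite (bigD1 i)//= eqxx expr1n big1 ?addr0// => j ji.
    by rewrite eq_sym (negbTE ji) expr0n.
  rewrite sumr_const card_ord.
  have : k%:R <= k.+1%:R :> R by rewrite ler_nat.
  have : 0 <= k%:R :> R by [].
  nra.
have [delta cd _] := gauss_cov_add_lin hE.
have [d0 mphi _] := cd.
have sE x : sqn (add_lin E x) = (1 - t) ^+ 2 * sqn x.
  rewrite /sqn mulr_sumr; apply: eq_bigr => i _; rewrite tnth_mktuple.
  rewrite (bigD1 i)//= big1 => [|j ji]; last by rewrite /E eq_sym (negbTE ji) mulr0 mul0r.
  by rewrite /E eqxx/= mulr1; ring.
apply: (@gintegrable_le _ _ (fun x => (delta * (t * (2 - t)) / 2)^-1 * cov_weight delta (add_lin E) x)).
- exact: measurable_sqn.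
- move=> x; have s0 : 0 <= sqn x by apply: sumr_ge0 => i _; exact: sqr_ge0.
  have a0 : 0 < delta * (t * (2 - t)) / 2.
    by rewrite divr_gt0// mulr_gt0// mulr_gt0//; lra.
  rewrite ger0_norm// ler_pdivlMl// /cov_weight sE -!mulrA ler_wpM2l//; first exact: ltW.
  apply: le_trans (expR_ge1Dx _).
  nra.
- by apply: gintegrableZ; exact: gintegrable_cov_weight.
Qed.

Lemma gintegrable_quad_form k (M : 'I_k -> 'I_k -> R) : gintegrable (quad_form M).
Proof.
apply: gintegrable_sum => i; apply: gintegrable_sum => j; apply: gintegrableZ.
apply: gintegrable_le (@gintegrable_sqn k).
  by apply: measurable_funM; exact: measurable_tnth.
move=> x; rewrite normrM.
have h l : tnth x l ^+ 2 <= sqn x.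
  by rewrite /sqn (bigD1 l)//= lerDl; apply: sumr_ge0 => ? _; exact: sqr_ge0.
have := h i; have := h j; rewrite -(real_normK (num_real (tnth x i))) -(real_normK (num_real (tnth x j))).
have := sqr_ge0 (`|tnth x i| - `|tnth x j|); nra.
Qed.

(** The logarithm of the weight of add_lin M, except that the logarithm of the
    Jacobian constant is replaced by its lower bound. *)
Definition log_weight_lb k (M : 'I_k -> 'I_k -> R) (x : vec k) : R :=
  mtr M - 2 * hs_sq M + (sqn x - sqn (add_lin M x)) / 2.

Lemma log_weight_lbE k (M : 'I_k -> 'I_k -> R) (x : vec k) : log_weight_lb M x =
  (mtr M - 2 * hs_sq M) - (quad_form M x + 2^-1 * quad_form (gram M) x).
Proof. by rewrite /log_weight_lb sqn_add_lin; field. Qed.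

Lemma gintegrable_log_weight_lb k (M : 'I_k -> 'I_k -> R) : gintegrable (log_weight_lb M).
Proof.
rewrite (funext (log_weight_lbE M)).
apply: gintegrableB; first exact: gintegrable_cst.
apply: gintegrableD; first exact: gintegrable_quad_form.
by apply: gintegrableZ; exact: gintegrable_quad_form.
Qed.

Lemma gmean_log_weight_lb k (M : 'I_k -> 'I_k -> R) : gmean (log_weight_lb M) =
  mtr M - 2 * hs_sq M - (gmean (quad_form M) + 2^-1 * gmean (quad_form (gram M))).
Proof.
have i1 := gintegrable_quad_form M; have i2 := gintegrable_quad_form (gram M).
rewrite (funext (log_weight_lbE M)) gmeanB; [|exact: gintegrable_cst|by apply: gintegrableD => //; exact: gintegrableZ].
by rewrite gmean_cst gmeanD//; [rewrite gmeanZ|exact: gintegrableZ].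
Qed.

Lemma expR_log_weight_lb k delta (M : 'I_k -> 'I_k -> R) x :
  expR (mtr M - 2 * hs_sq M) <= delta -> expR (log_weight_lb M x) <= cov_weight delta (add_lin M) x.
Proof. by move=> h; rewrite /log_weight_lb expRD /cov_weight ler_wpM2r// expR_ge0. Qed.

(** Second moments without computing any integral.  The weight of I + t M has
    mean 1, so the mean of its logarithm is at most 0; to first order in t this
    reads t (tr M - mean of x . M x) <= O(t^2), for t of either sign. *)
Lemma gmean_quad_form k (M : 'I_k -> 'I_k -> R) : gmean (quad_form M) = mtr M.
Proof.
apply/esym/eqP; rewrite -subr_eq0; apply/eqP.
pose t0 : R := (5 * (1 + hs_sq M))^-1.
have h0 := hs_sq_ge0 M.
have t00 : 0 < t0 by rewrite invr_gt0 mulr_gt0//; lra.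
have t0E : t0 * (1 + hs_sq M) = 5^-1 by rewrite /t0; field; apply: lt0r_neq0; lra.
apply: (@lin_quad_le _ _ (2 * hs_sq M + 2^-1 * gmean (quad_form (gram M))) t0 t00) => t ht.
have hE : hs_sq (fun i j => t * M i j) <= 25^-1.
  have : t ^+ 2 <= t0 ^+ 2.
    rewrite -(real_normK (num_real t)); have := normr_ge0 t; nra.
  rewrite hs_sqZ; nra.
have [delta cd hd] := gauss_cov_add_lin hE.
have : gmean (log_weight_lb (fun i j => t * M i j)) <= 0.
  rewrite -[leRHS](subrr 1) -{1}(gmean_cov_weight cd) -(gmean_cst k 1) -gmeanB; last 2 first.
  - exact: gintegrable_cov_weight.
  - exact: gintegrable_cst.
  apply: gmean_le; first exact: gintegrable_log_weight_lb.
    by apply: gintegrableB; [exact: gintegrable_cov_weight|exact: gintegrable_cst].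
  move=> x; have := expR_log_weight_lb x hd; have := expR_ge1Dx (log_weight_lb (fun i j => t * M i j) x).
  lra.
have gZ x : quad_form (gram (fun i j => t * M i j)) x = t ^+ 2 * quad_form (gram M) x.
  rewrite -quad_formZ /quad_form; apply: eq_bigr => i _; apply: eq_bigr => j _; congr (_ * _).
  by rewrite /gram mulr_sumr; apply: eq_bigr => l _; ring.
rewrite gmean_log_weight_lb mtrZ hs_sqZ (funext (quad_formZ t M)) (funext gZ) !gmeanZ; [|exact: gintegrable_quad_form..].
by lra.
Qed.

Lemma measurable_add_lin k (E : 'I_k -> 'I_k -> R) : measurable_fun setT (add_lin E).
Proof.
apply/measurable_fun_tnthP => i.
rewrite (_ : _ \o _ = fun x : vec k => tnth x i + dotr (E i) x).
  by apply: measurable_funD; [exact: measurable_tnth|exact: measurable_dotr].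
by apply/funext => x; rewrite /= tnth_mktuple.
Qed.

Lemma gauss_gmean k (A : set (vec k)) : measurable A ->
  gauss k A = (gmean (\1_A))%:E.
Proof.
move=> mA; rewrite /gmean /Rintegral integral_indic// setIT fineK//.
exact: fin_num_measure.
Qed.

(** The difference of the two probabilities is the integral of the indicator of
    (I + E) x in A against 1 - rho, and |rho - 1| is integrated with
    [abs_sub1_le]. *)
Theorem gauss_add_lin_TV k (E : 'I_k -> 'I_k -> R) s (A : set (vec k)) :
  0 < s -> hs_sq E <= s ^+ 2 -> measurable A ->
  (`|gauss k (add_lin E @^-1` A) - gauss k A| <= (5 * s)%:E)%E.
Proof.
move=> s0 hE mA.
have mphi := measurable_add_lin E.
have mB : measurable (add_lin E @^-1` A) by rewrite -[X in measurable X]setTI; exact: mphi.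
have fin B : measurable B -> exists2 r : R, gauss k B = r%:E & 0 <= r <= 1.
  move=> mB'; exists (fine (gauss k B)); first by rewrite fineK//; exact: fin_num_measure.
  rewrite fine_ge0//=.
  by rewrite -lee_fin fineK; [exact: probability_le1|exact: fin_num_measure].
have [s1|s1] := leP s 5^-1; last first.
  have [r1 -> h1] := fin _ mB; have [r2 -> h2] := fin _ mA.
  by rewrite -EFinB/= lee_fin ler_norml; apply/andP; split; lra.
have hE' : hs_sq E <= 25^-1 by nra.
have [delta cd hd] := gauss_cov_add_lin hE'.
have [d0 _ cov] := cd.
set rho := cov_weight delta (add_lin E).
have mI : measurable_fun setT (\1_A : vec k -> R) by exact: measurable_indic.
have mIphi : measurable_fun setT (fun x => \1_A (add_lin E x) : R).
  exact: (measurableT_comp mI mphi).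
have I01 x : 0 <= (\1_A x : R) <= 1 by rewrite indicE; case: (x \in A); rewrite /= ?lexx ?ler01.
have irho : gintegrable rho by exact: gintegrable_cov_weight.
have rho0 x : 0 < rho x by exact: cov_weight_gt0.
have i1 : gintegrable (fun x => \1_A (add_lin E x)).
  apply: gintegrable_le (gintegrable_cst k 1) => // x.
  by have := I01 (add_lin E x); rewrite ler_norml; lra.
have i2 : gintegrable (fun x => \1_A (add_lin E x) * rho x).
  apply: gintegrable_le irho => [|x].
    by apply: measurable_funM => //; exact: measurable_cov_weight.
  have := I01 (add_lin E x); have := rho0 x; rewrite ler_norml => h1 h2.
  by apply/andP; split; nra.
have e1 : gauss k (add_lin E @^-1` A) = (gmean (fun x => \1_A (add_lin E x)))%:E.
  by rewrite gauss_gmean.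
have e2 : gauss k A = (gmean (fun x => \1_A (add_lin E x) * rho x))%:E.
  have mIE : measurable_fun setT (fun x : vec k => (\1_A x)%:E : \bar R).
    exact/measurable_EFinP.
  have IE0 (x : vec k) : (0 <= (\1_A x)%:E :> \bar R)%E by rewrite lee_fin; case/andP: (I01 x).
  by rewrite gauss_gmean// /gmean /Rintegral -(cov _ mIE IE0).
rewrite e1 e2 -EFinB -gmeanB// lee_fin.
have iB : gintegrable (fun x => \1_A (add_lin E x) - \1_A (add_lin E x) * rho x) by exact: gintegrableB.
apply: (le_trans (le_normr_Rintegral measurableT iB)).
have il := gintegrable_log_weight_lb E.
pose bnd x := (2 * s)^-1 * (rho x - 1 - log_weight_lb E x) + s * (rho x + 1).
have ib1 : gintegrable (fun x => rho x - 1 - log_weight_lb E x).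
  by apply: gintegrableB => //; apply: gintegrableB => //; exact: gintegrable_cst.
have ib2 : gintegrable (fun x => rho x + 1) by apply: gintegrableD => //; exact: gintegrable_cst.
apply: (@le_trans _ _ (gmean bnd)).
  apply: gmean_le.
  - exact: integrable_norm.
  - by apply: gintegrableD; exact: gintegrableZ.
  - move=> x; apply: le_trans (abs_sub1_le s0 (expR_log_weight_lb x hd)).
    rewrite -[X in X - _]mulr1 -mulrBr normrM distrC ler_piMl//.
    by rewrite ger0_norm; case/andP: (I01 (add_lin E x)).
rewrite /bnd gmeanD; [|exact: gintegrableZ|exact: gintegrableZ].
rewrite !gmeanZ// !gmeanB//; [|exact: gintegrable_cst|by apply: gintegrableB => //; exact: gintegrable_cst].
rewrite gmeanD//; last exact: gintegrable_cst.
rewrite (gmean_cov_weight cd) gmean_cst gmean_log_weight_lb !gmean_quad_form mtr_gram.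
have -> : (2 * s)^-1 * (1 - 1 - (mtr E - 2 * hs_sq E - (mtr E + 2^-1 * hs_sq E))) =
    (2 * s)^-1 * (5 / 2 * hs_sq E) by congr (_ * _); lra.
have : (2 * s)^-1 * (5 / 2 * hs_sq E) <= 5 / 4 * s.
  by rewrite ler_pdivrMl; [nra|lra].
lra.
Qed.

End TV.

(** * Symmetric tensors of order four *)

Section Perm4.
Variable I : eqType.
Implicit Types i j k l a b c d : I.

Let pick2 i j a b : perm_eq [:: i; j] [:: a; b] ->
  (i = a /\ j = b) \/ (j = a /\ i = b).
Proof.
have h1 x y : perm_eq [:: x] [:: y] -> x = y by move=> /perm_small_eq-/(_ isT)[].
by case/perm_consP => -[|[|m]] [u [[<- <-]]] /h1 <-; [left|right|left].
Qed.

Let pick3 i j k a b c : perm_eq [:: i; j; k] [:: a; b; c] ->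
  [\/ i = a /\ perm_eq [:: j; k] [:: b; c], j = a /\ perm_eq [:: k; i] [:: b; c] |
      k = a /\ perm_eq [:: i; j] [:: b; c]].
Proof.
by case/perm_consP => -[|[|[|m]]] [u [[<- <-]]] h;
  [apply: Or31|apply: Or32|apply: Or33|apply: Or31].
Qed.

Let pick4 i j k l a b c d : perm_eq [:: i; j; k; l] [:: a; b; c; d] ->
  [\/ i = a /\ perm_eq [:: j; k; l] [:: b; c; d],
      j = a /\ perm_eq [:: k; l; i] [:: b; c; d],
      k = a /\ perm_eq [:: l; i; j] [:: b; c; d] |
      l = a /\ perm_eq [:: i; j; k] [:: b; c; d]].
Proof.
by case/perm_consP => -[|[|[|[|m]]]] [u [[<- <-]]] h;
  [apply: Or41|apply: Or42|apply: Or43|apply: Or44|apply: Or41].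
Qed.

(** Adjacent transpositions generate all permutations of four arguments; each
    possible position of a is brought to the front by a rotation. *)
Lemma sym4_perm_eq (X : Type) (f : I -> I -> I -> I -> X) i j k l a b c d :
  (forall i j k l, f i j k l = f j i k l) ->
  (forall i j k l, f i j k l = f i k j l) ->
  (forall i j k l, f i j k l = f i j l k) ->
  perm_eq [:: i; j; k; l] [:: a; b; c; d] -> f i j k l = f a b c d.
Proof.
move=> s12 s23 s34.
have rot3 x y z t : f x y z t = f x z t y by rewrite s23 s34.
have rot4 x y z t : f x y z t = f y z t x by rewrite s12 rot3.
have p2 x y z t z' t' : perm_eq [:: z; t] [:: z'; t'] -> f x y z t = f x y z' t'.
  by case/pick2 => -[-> ->] //; rewrite s34.
have p3 x y z t y' z' t' : perm_eq [:: y; z; t] [:: y'; z'; t'] ->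
    f x y z t = f x y' z' t'.
  by case/pick3 => -[-> h]; [|rewrite rot3|rewrite rot3 rot3]; exact: p2.
by case/pick4 => -[-> h]; [|rewrite rot4|rewrite rot4 rot4|rewrite rot4 rot4 rot4];
  exact: p3.
Qed.
End Perm4.

Section Tensor.
Context {R : realType}.
Variable n : nat.
Local Notation I := 'I_n.
Implicit Types (u v w : 'rV[R]_n) (m : I -> I -> R).

Lemma perm_eq_tuple4 (X : Type) (f : I -> I -> I -> I -> X) (s t : 4.-tuple I) :
  (forall i j k l, f i j k l = f j i k l) ->
  (forall i j k l, f i j k l = f i k j l) ->
  (forall i j k l, f i j k l = f i j l k) ->
  perm_eq s t ->
  f (tnth s 0) (tnth s 1) (tnth s 2%:R) (tnth s 3%:R) = f (tnth t 0) (tnth t 1) (tnth t 2%:R) (tnth t 3%:R).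
Proof.
move=> h1 h2 h3.
case: s => -[|i [|j [|k [|l []]]]] // Hs; case: t => -[|a [|b [|c [|d []]]]] // Ht h.
exact: sym4_perm_eq h.
Qed.

Lemma sort_tupleI (t : 4.-tuple I) :
  sorted (fun i j : I => i <= j)%N (sort_tuple (fun i j : I => i <= j)%N t).
Proof. by apply: sort_sorted => i j; exact: leq_total. Qed.

(** The representative of the multiset underlying a multi-index. *)
Definition sort_index (t : 4.-tuple I) : sorted_index n :=
  exist (fun s : 4.-tuple I => is_true (sorted (fun i j : I => i <= j)%N s)) _
    (sort_tupleI t).

Lemma perm_sort_index t : perm_eq (sval (sort_index t)) t.
Proof. by rewrite /= perm_sort. Qed.

Lemma sort_index_eq t (s : sorted_index n) : (sort_index t == s) = perm_eq t (sval s).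
Proof.
apply/eqP/idP => [<-|h]; first by rewrite perm_sym perm_sort_index.
apply/val_inj/val_inj; apply: (@sorted_eq _ (fun i j : I => i <= j)%N).
- by move=> ? ? ?; exact: leq_trans.
- by move=> i j /anti_leq/val_inj.
- exact: (svalP (sort_index t)).
- exact: (svalP s).
- exact: perm_trans (perm_sort_index t) h.
Qed.

Definition mvec m u i : R := \sum_j m i j * u 0 j.
Definition mdot m u : R := \sum_i u 0 i * mvec m u i.

(** For unit u and symmetric m, the symmetric tensor T of least Frobenius norm
    with T . (u (x) u) = m.  In the frame where u is the first
    basis vector, and as quartic forms, a quadratic form
    a x^2 + 2 x (b . y) + D(y) is sent to
    a x^4 + 4 x^3 (b . y) + 6 x^2 D(y); the coefficients 1, -2, 3 express this
    without a choice of frame. *)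
Definition lift_sym4 u m i j k l : R :=
  m i j * u 0 k * u 0 l + m i k * u 0 j * u 0 l + m i l * u 0 j * u 0 k
  + m j k * u 0 i * u 0 l + m j l * u 0 i * u 0 k + m k l * u 0 i * u 0 j
  - 2 * (mvec m u i * u 0 j * u 0 k * u 0 l + mvec m u j * u 0 i * u 0 k * u 0 l
       + mvec m u k * u 0 i * u 0 j * u 0 l + mvec m u l * u 0 i * u 0 j * u 0 k)
  + 3 * (mdot m u * u 0 i * u 0 j * u 0 k * u 0 l).

Lemma unit_sphere_sum u : unit_sphere u -> \sum_i u 0 i ^+ 2 = 1.
Proof.
rewrite /unit_sphere/= /norm2 => h.
by rewrite -[LHS]sqr_sqrtr ?h ?expr1n// sumr_ge0// => i _; exact: sqr_ge0.
Qed.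

Let sq2 (x y : R) : (x + y) ^+ 2 <= 2 * (x ^+ 2 + y ^+ 2).
Proof. by have := sqr_ge0 (x - y); nra. Qed.

Let sq3 (x y z : R) : (x + y + z) ^+ 2 <= 3 * (x ^+ 2 + y ^+ 2 + z ^+ 2).
Proof.
rewrite -subr_ge0.
rewrite (_ : _ - _ = (x - y) ^+ 2 + (x - z) ^+ 2 + (y - z) ^+ 2); last by ring.
by rewrite !addr_ge0 ?sqr_ge0.
Qed.

Lemma sum_lin5 (c0 c1 c2 c3 c4 : R) (f0 f1 f2 f3 f4 : I -> R) :
  \sum_l (c0 * f0 l + c1 * f1 l + c2 * f2 l + c3 * f3 l + c4 * f4 l) =
  c0 * \sum_l f0 l + c1 * \sum_l f1 l + c2 * \sum_l f2 l + c3 * \sum_l f3 l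
  + c4 * \sum_l f4 l.
Proof. by rewrite !big_split/= -!mulr_sumr. Qed.

(** Each contraction of lift_sym4 with u only involves these five monomials
    in the contracted index. *)
Lemma contract_monomials u m i j k (c0 c1 c2 c3 c4 : R) : unit_sphere u ->
  \sum_l (c0 * u 0 l ^+ 2 + c1 * (m i l * u 0 l) + c2 * (m j l * u 0 l)
         + c3 * (m k l * u 0 l) + c4 * (u 0 l * mvec m u l)) =
  c0 + c1 * mvec m u i + c2 * mvec m u j + c3 * mvec m u k + c4 * mdot m u.
Proof.
move=> /unit_sphere_sum u1.
by rewrite sum_lin5 u1 mulr1.
Qed.

Lemma lift_sym4_contract u m i j : unit_sphere u ->
  \sum_k \sum_l lift_sym4 u m i j k l * u 0 k * u 0 l = m i j.
Proof.
move=> u1.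
pose ui := u 0 i; pose uj := u 0 j; pose vi := mvec m u i; pose vj := mvec m u j.
pose a := mdot m u.
(* Contract the last index first; the result is again a combination of the five monomials, now in k. *)
have inner k : \sum_l lift_sym4 u m i j k l * u 0 k * u 0 l =
    (m i j - 2 * (vi * uj + vj * ui) + 3 * a * ui * uj
      + vi * uj + vj * ui - 2 * a * ui * uj) * u 0 k ^+ 2
    + uj * (m i k * u 0 k) + ui * (m j k * u 0 k) + 0 * (m i k * u 0 k)
    + (- 2 * ui * uj + ui * uj) * (u 0 k * mvec m u k).
  transitivity (\sum_l ((u 0 k * (m i j * u 0 k + m i k * uj + m j k * ui
      - 2 * (vi * uj * u 0 k + vj * ui * u 0 k + mvec m u k * ui * uj)
      + 3 * a * ui * uj * u 0 k)) * u 0 l ^+ 2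
    + (uj * u 0 k ^+ 2) * (m i l * u 0 l) + (ui * u 0 k ^+ 2) * (m j l * u 0 l)
    + (ui * uj * u 0 k) * (m k l * u 0 l)
    + (- 2 * ui * uj * u 0 k ^+ 2) * (u 0 l * mvec m u l))).
    by apply: eq_bigr => l _; rewrite /lift_sym4 /ui /uj /vi /vj /a; ring.
  by rewrite contract_monomials// /ui /uj /vi /vj /a; ring.
rewrite (eq_bigr _ (fun k _ => inner k)) contract_monomials//.
by rewrite -/vi -/vj -/a; ring.
Qed.

Definition frob_sq m : R := \sum_i \sum_j m i j ^+ 2.

(** Every one of the eleven terms has squared norm at most that of m, times its
    squared coefficient.  The four indices are summed one after the other; since
    u is a unit vector each summation is an instance of [sum_lin5]. *)
Lemma lift_sym4_norm u m : unit_sphere u ->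
  \sum_i \sum_j \sum_k \sum_l lift_sym4 u m i j k l ^+ 2 <= 341 * frob_sq m.
Proof.
move=> u1; have u1' := unit_sphere_sum u1.
have v2 : \sum_i mvec m u i ^+ 2 <= frob_sq m.
  apply: ler_sum => i _; apply: le_trans (cauchy_schwarz _ _) _.
  by rewrite u1' mulr1.
have a2 : mdot m u ^+ 2 <= frob_sq m.
  by apply: le_trans (cauchy_schwarz _ _) _; rewrite u1' mul1r.
pose q i := u 0 i ^+ 2; pose r i := mvec m u i ^+ 2; pose p i j := m i j ^+ 2.
have q1 : \sum_i q i = 1 by [].
(* 18 = 3 * 6, 48 = 3 * 4 * 2^2, 27 = 3 * 3^2: three groups of 6, 4 and 1 like terms,
   whose coefficients in lift_sym4 are 1, 2 and 3. *)
pose F i j k l :=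
   18 * (q k * q l * p i j + q j * q l * p i k + q j * q k * p i l
    + q i * q l * p j k + q i * q k * p j l + q i * q j * p k l)
   + 48 * (r i * q j * q k * q l + r j * q i * q k * q l + r k * q i * q j * q l
         + r l * q i * q j * q k) + 27 * (mdot m u ^+ 2 * q i * q j * q k * q l).
have Fle i j k l : lift_sym4 u m i j k l ^+ 2 <= F i j k l.
  pose x1 := m i j * u 0 k * u 0 l; pose x2 := m i k * u 0 j * u 0 l.
  pose x3 := m i l * u 0 j * u 0 k; pose x4 := m j k * u 0 i * u 0 l.
  pose x5 := m j l * u 0 i * u 0 k; pose x6 := m k l * u 0 i * u 0 j.
  pose y1 := mvec m u i * u 0 j * u 0 k * u 0 l.
  pose y2 := mvec m u j * u 0 i * u 0 k * u 0 l.
  pose y3 := mvec m u k * u 0 i * u 0 j * u 0 l.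
  pose y4 := mvec m u l * u 0 i * u 0 j * u 0 k.
  pose z := mdot m u * u 0 i * u 0 j * u 0 k * u 0 l.
  have -> : F i j k l = 18 * (x1 ^+ 2 + x2 ^+ 2 + x3 ^+ 2 + x4 ^+ 2 + x5 ^+ 2 + x6 ^+ 2)
      + 48 * (y1 ^+ 2 + y2 ^+ 2 + y3 ^+ 2 + y4 ^+ 2) + 27 * z ^+ 2.
    by rewrite /F /q /r /p /x1 /x2 /x3 /x4 /x5 /x6 /y1 /y2 /y3 /y4 /z; ring.
  have -> : lift_sym4 u m i j k l = x1 + x2 + x3 + (x4 + x5 + x6)
      + - 2 * (y1 + y2 + (y3 + y4)) + 3 * z.
    by rewrite /lift_sym4 /x1 /x2 /x3 /x4 /x5 /x6 /y1 /y2 /y3 /y4 /z; ring.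
  have hA := sq2 (x1 + x2 + x3) (x4 + x5 + x6).
  have hA1 := sq3 x1 x2 x3; have hA2 := sq3 x4 x5 x6.
  have hB := sq2 (y1 + y2) (y3 + y4).
  have hB1 := sq2 y1 y2; have hB2 := sq2 y3 y4.
  apply: le_trans (sq3 _ _ _) _.
  rewrite [(- 2 * _) ^+ 2]exprMn [(3 * z) ^+ 2]exprMn.
  by clearbody x1 x2 x3 x4 x5 x6 y1 y2 y3 y4 z; lra.
apply: (@le_trans _ _ (\sum_i \sum_j \sum_k \sum_l F i j k l)).
  by do 4 (apply: ler_sum => ? _); exact: Fle.
pose Pm i := \sum_l p i l; pose Rv := \sum_l r l; pose a := mdot m u ^+ 2.
have sumP : \sum_i Pm i = frob_sq m by [].
have E1 i j k : \sum_l F i j k l =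
  18 * (q k * p i j + q j * p i k + q i * p j k)
  + 48 * (r i * q j * q k + r j * q i * q k + r k * q i * q j)
  + 27 * (a * q i * q j * q k)
  + 18 * (q j * q k * Pm i + q i * q k * Pm j + q i * q j * Pm k)
  + 48 * (q i * q j * q k * Rv).
  transitivity (\sum_l ((18 * (q k * p i j + q j * p i k + q i * p j k)
    + 48 * (r i * q j * q k + r j * q i * q k + r k * q i * q j)
    + 27 * (a * q i * q j * q k)) * q l
    + 18 * q j * q k * p i l + 18 * q i * q k * p j l + 18 * q i * q j * p k l
    + 48 * q i * q j * q k * r l)).
    by apply: eq_bigr => l _; rewrite /F /a; ring.
  rewrite sum_lin5 q1 -/(Pm i) -/(Pm j) -/(Pm k) -/Rv; ring.
have E2 i j : \sum_k \sum_l F i j k l =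
  18 * p i j + 48 * (r i * q j + r j * q i) + 27 * (a * q i * q j)
  + 36 * (q j * Pm i + q i * Pm j) + 96 * (q i * q j * Rv) + 18 * (q i * q j * frob_sq m).
  rewrite (eq_bigr _ (fun k _ => E1 i j k)).
  transitivity (\sum_k ((18 * p i j + 48 * (r i * q j + r j * q i)
    + 27 * (a * q i * q j) + 18 * (q j * Pm i + q i * Pm j) + 48 * (q i * q j * Rv)) * q k
    + 18 * q j * p i k + 18 * q i * p j k + 18 * q i * q j * Pm k
    + 48 * q i * q j * r k)).
    by apply: eq_bigr => k _; ring.
  rewrite sum_lin5 q1 -/(Pm i) -/(Pm j) -/Rv sumP; ring.
have E3 i : \sum_j \sum_k \sum_l F i j k l =
  54 * Pm i + 48 * r i + 27 * (a * q i) + 144 * (q i * Rv) + 54 * (q i * frob_sq m).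
  rewrite (eq_bigr _ (fun k _ => E2 i k)).
  transitivity (\sum_j ((48 * r i + 27 * a * q i + 36 * Pm i + 96 * q i * Rv
     + 18 * q i * frob_sq m) * q j + 18 * p i j + 48 * q i * r j + 36 * q i * Pm j + 0 * q j)).
    by apply: eq_bigr => k _; ring.
  rewrite sum_lin5 q1 -/(Pm i) -/Rv sumP; ring.
rewrite (eq_bigr _ (fun k _ => E3 k)).
rewrite (eq_bigr (fun i => 54 * Pm i + 48 * r i + (27 * a + 144 * Rv + 54 * frob_sq m) * q i
  + 0 * q i + 0 * q i)) => [|i _]; last by ring.
rewrite sum_lin5 q1 sumP -/Rv.
have : Rv <= frob_sq m by [].
rewrite -/a in a2; have : 0 <= frob_sq m; last lra.
by do 2 (apply: sumr_ge0 => ? _); exact: sqr_ge0.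
Qed.

End Tensor.

(** * The law of the tensor in normalized coordinates *)

Section Law.
Context {R : realType}.
Local Notation vec k := (k.-tuple (measurableTypeR R)).
Implicit Type k : nat.

Definition box k (B : 'I_k -> set (measurableTypeR R)) : set (vec k) :=
  [set x | forall i, B i (tnth x i)].

Lemma measurable_box k (B : 'I_k -> set (measurableTypeR R)) :
  (forall i, measurable (B i)) -> measurable (box B).
Proof.
move=> mB; rewrite (_ : box B = \bigcap_(i in [set: 'I_k]) ((@tnth _ _ ^~ i) @^-1` B i)).
  apply: fin_bigcap_measurable => // i _.
  by rewrite -[X in measurable X]setTI; exact: measurable_tnth.
by apply/seteqP; split => x /= h i; [move=> _|]; apply: h.
Qed.

(** Boxes are stable under intersection and generate the product
    sigma-algebra. *)
Lemma box_measure_unique k (m1 m2 : probability (vec k) R) :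
  (forall B : 'I_k -> set (measurableTypeR R), (forall i, measurable (B i)) ->
     m1 (box B) = m2 (box B)) ->
  forall A, measurable A -> m1 A = m2 A.
Proof.
move=> h A mA.
pose G := [set C | exists2 B : 'I_k -> set (measurableTypeR R),
  (forall i, measurable (B i)) & C = box B].
have boxT : box (fun=> setT) = setT :> set (vec k) by apply/seteqP; split.
apply: (measure_unique G (fun=> setT)) => //.
- apply/seteqP; split; last first.
    apply: smallest_sub; first exact: sigma_algebra_measurable.
    by move=> _ [B mB ->]; exact: measurable_box.
  apply: smallest_sub; first exact: smallest_sigma_algebra.
  move=> C; rewrite -bigcup_seq => -[i _ [B mB <-]].
  apply: sub_sigma_algebra; exists (fun j => if j == i then B else setT).
    by move=> j; case: ifP.
  rewrite setTI; apply/seteqP; split => x /=.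
    by move=> Bx j; case: eqP => // ->.
  by move=> /(_ i); rewrite eqxx.
- move=> _ _ [B mB ->] [D mD ->]; exists (fun i => B i `&` D i).
    by move=> i; exact: measurableI.
  apply/seteqP; split => x /=; first by move=> [h1 h2] i; split.
  by move=> h'; split => i; case: (h' i).
- by move=> _; exists (fun=> setT).
- by rewrite bigcup_const.
- by move=> _ [B mB ->]; exact: h.
- by move=> _; rewrite ltey_eq fin_num_measure.
Qed.

Lemma gauss_box k (B : 'I_k -> set (measurableTypeR R)) :
  (forall i, measurable (B i)) ->
  gauss k (box B) = (\prod_(i < k) stdnormal (B i))%E.
Proof.
elim: k B => [|k IH] B mB.
  rewrite big_ord0 /= diracE mem_set//; by case.
rewrite big_ord_recl -(IH (fun i => B (lift ord0 i)))//.
rewrite -product_measure1E//; last by apply: measurable_box.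
congr ((_ \x _) _)%E; apply/seteqP; split => -[x y] /=.
  move=> h; split; first exact: (h ord0).
  by move=> i; have := h (lift ord0 i); rewrite tnthS.
by move=> [h1 h2] i; case: (unliftP ord0 i) => [j|] -> //=; rewrite tnthS; exact: h2.
Qed.

Section GOTE.
Context d (T : measurableType d) (P : probability T R) (n : nat).
Variables (G : 4.-tuple 'I_n -> {RV P >-> R}).
Hypothesis GG : is_GOTE4 G.

Definition gote_sd (s : 4.-tuple 'I_n) : R := Num.sqrt (4 / (nb_perm s)%:R).

Lemma gote_sd_gt0 s : 0 < gote_sd s.
Proof.
rewrite sqrtr_gt0 divr_gt0// ltr0n; apply/card_gt0P; exists s.
by rewrite inE; exact: perm_refl.
Qed.

(** Dividing by the standard deviations makes the independent entries standard
    Gaussian; in these coordinates the Euclidean norm is half the Frobenius norm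
    of the tensor. *)
Definition gote_coords (w : T) : vec #|sorted_index n| :=
  [tuple G (sval (enum_val i)) w / gote_sd (sval (enum_val i)) | i < #|sorted_index n|].

Lemma measurable_gote_coords : measurable_fun setT gote_coords.
Proof.
apply/measurable_fun_tnthP => i.
rewrite (_ : _ \o _ = fun w => G (sval (enum_val i)) w / gote_sd (sval (enum_val i))).
  exact: measurable_funM.
by apply/funext => w; rewrite /= tnth_mktuple.
Qed.

HB.instance Definition _ := isMeasurableFun.Build _ _ _ _ gote_coords measurable_gote_coords.

Lemma gote_coords_law A : measurable A -> P (gote_coords @^-1` A) = gauss #|sorted_index n| A.
Proof.
case: GG => _ ind law.
move=> mA; have := @box_measure_unique _ (distribution P gote_coords) (gauss #|sorted_index n|).
apply => // B mB; rewrite gauss_box//.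
pose B' (s : sorted_index n) := [set x : R | B (enum_rank s) (x / gote_sd (sval s))].
have mB' s : measurable (B' s).
  rewrite -[X in measurable X]setTI.
  have h : measurable_fun setT (fun x : R => x / gote_sd (sval s)) by exact: measurable_funM.
  exact: (h measurableT _ (mB (enum_rank s))).
have := ind [set: sorted_index n]%SET B' mB'.
rewrite (_ : \bigcap_(i in _) _ = gote_coords @^-1` box B); last first.
  apply/seteqP; split => w /= h i.
    rewrite /gote_coords tnth_mktuple; have := h (enum_val i).
    by rewrite /B'/= enum_valK; apply; rewrite inE.
  move=> _; have := h (enum_rank i).
  by rewrite /gote_coords tnth_mktuple enum_rankK.
move=> indE; apply: (etrans indE).
rewrite (eq_bigl xpredT) => [|s]; last by rewrite inE.
rewrite (reindex (@enum_val _ (mem (sorted_index n))))/=; last first.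
  by exists enum_rank => i _; rewrite ?enum_valK ?enum_rankK.
apply: eq_bigr => i _.
rewrite -(stdnormal_scale (gote_sd_gt0 (sval (enum_val i))) (mB i)).
by apply: (etrans (law (sval (enum_val i)) (B' (enum_val i)) (mB' _))); rewrite /B' enum_valK.
Qed.

End GOTE.
End Law.

(** * Two contractions as one linear perturbation *)

Section Final.
Context {R : realType}.
Variable n : nat.
Local Notation I := 'I_n.
Local Notation S := (sorted_index n).
Implicit Types (u v w : 'rV[R]_n) (m : I -> I -> R).
Local Notation gote_sd := (@gote_sd R n).

Lemma sum_tuple4 (f : 4.-tuple I -> R) :
  \sum_t f t = \sum_i \sum_j \sum_k \sum_l f [tuple i; j; k; l].
Proof.
rewrite pair_bigA/= pair_bigA/= pair_bigA/=.
pose h (t : 4.-tuple I) := (tnth t 0, tnth t 1, tnth t 2%:R, tnth t 3%:R).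
rewrite (reindex (fun p : I * I * I * I => [tuple p.1.1.1; p.1.1.2; p.1.2; p.2]))//.
exists h => [[[[i j] k] l] _ //|t _].
by apply: val_inj; case: t => -[|i [|j [|k [|l []]]]].
Qed.

Definition eval_tuple4 (f : I -> I -> I -> I -> R) (t : 4.-tuple I) :=
  f (tnth t 0) (tnth t 1) (tnth t 2%:R) (tnth t 3%:R).

(** The contraction with u, w of the tensor that is the indicator of the
    class s of multi-indices. *)
Definition class_contract u w (s : S) i j : R :=
  \sum_k \sum_l (sort_index [tuple i; j; k; l] == s)%:R * u 0 k * w 0 l.

Lemma sort_index_perm (s t : 4.-tuple I) : perm_eq s t -> sort_index s = sort_index t.
Proof.
move=> h; apply/eqP; rewrite sort_index_eq; apply: perm_trans h _.
by rewrite perm_sym perm_sort_index.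
Qed.

Lemma class_contract_sym u w s i j : class_contract u w s i j = class_contract u w s j i.
Proof.
apply: eq_bigr => k _; apply: eq_bigr => l _; rewrite (@sort_index_perm _ [tuple j; i; k; l])//.
by apply/permPl; exact: (perm_catCA [:: i] [:: j] [:: k; l]).
Qed.

Lemma lift_sym4_perm_eq u m (s t : 4.-tuple I) : (forall i j, m i j = m j i) ->
  perm_eq s t -> eval_tuple4 (lift_sym4 u m) s = eval_tuple4 (lift_sym4 u m) t.
Proof.
move=> ms; apply: perm_eq_tuple4 => i j k l; rewrite /lift_sym4.
- rewrite (ms j i); ring.
- rewrite (ms k j); ring.
- rewrite (ms l k); ring.
Qed.

Lemma lift_sym4_lin u c m1 m2 i j k l :
  lift_sym4 u (fun i j => c * m1 i j + m2 i j) i j k l =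
  c * lift_sym4 u m1 i j k l + lift_sym4 u m2 i j k l.
Proof.
have vE a : mvec (fun i j => c * m1 i j + m2 i j) u a = c * mvec m1 u a + mvec m2 u a.
  rewrite /mvec mulr_sumr -big_split/=; apply: eq_bigr => b _; ring.
have aE : mdot (fun i j => c * m1 i j + m2 i j) u = c * mdot m1 u + mdot m2 u.
  rewrite /mdot mulr_sumr -big_split/=; apply: eq_bigr => b _; rewrite vE; ring.
rewrite /lift_sym4 !vE aE; ring.
Qed.

Lemma lift_sym4_sum u (J : finType) (c : J -> R) (m : J -> I -> I -> R) i j k l :
  lift_sym4 u (fun i j => \sum_s c s * m s i j) i j k l =
  \sum_s c s * lift_sym4 u (m s) i j k l.
Proof.
rewrite -!/(index_enum J); elim: (index_enum J) => [|s r IH].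
  rewrite big_nil; have := lift_sym4_lin u (-1) (fun _ _ => 0) (fun _ _ => 0) i j k l.
  have -> : (fun i j : I => -1 * 0 + 0) = (fun _ _ => 0 : R).
    by apply/funext => a; apply/funext => b; rewrite mulr0 addr0.
  rewrite mulN1r addNr => h0.
  rewrite -[RHS]h0; apply: (congr1 (fun m0 => lift_sym4 u m0 i j k l)).
  by apply/funext => a; apply/funext => b; rewrite big_nil.
rewrite big_cons -IH -lift_sym4_lin; apply: (congr1 (fun m0 => lift_sym4 u m0 i j k l)).
by apply/funext => a; apply/funext => b; rewrite big_cons.
Qed.

(** The matrix E of the map g |-> B(g . (u (x) w)) in normalized coordinates. *)
Definition perturb_coef u w (s s' : S) : R :=
  gote_sd (sval s') / gote_sd (sval s) * eval_tuple4 (lift_sym4 u (class_contract u w s')) (sval s).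

Lemma nb_permE (s : S) : (nb_perm (sval s))%:R = \sum_t (sort_index t == s)%:R :> R.
Proof.
rewrite /nb_perm -sum1_card natr_sum big_mkcond/=; apply: eq_bigr => t _.
by rewrite sort_index_eq inE; case: ifP.
Qed.

Lemma nb_perm_gt0 (s : 4.-tuple I) : 0 < (nb_perm s)%:R :> R.
Proof. by rewrite ltr0n; apply/card_gt0P; exists s; rewrite inE; exact: perm_refl. Qed.

Lemma gote_sd2 (s : 4.-tuple I) : gote_sd s ^+ 2 = 4 / (nb_perm s)%:R.
Proof. by rewrite sqr_sqrtr// divr_ge0. Qed.

(** Cauchy-Schwarz on the pairs (k, l) for which (i, j, k, l) belongs to the
    class s: there are at most nb_perm s of them. *)
Lemma frob_sq_class_contract u w s : frob_sq (class_contract u w s) <= (nb_perm (sval s))%:R *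
  \sum_i \sum_j \sum_k \sum_l (sort_index [tuple i; j; k; l] == s)%:R * (u 0 k ^+ 2 * w 0 l ^+ 2).
Proof.
rewrite /frob_sq mulr_sumr; apply: ler_sum => i _; rewrite mulr_sumr; apply: ler_sum => j _.
rewrite /class_contract !pair_bigA/=.
rewrite (eq_bigr (fun p : I * I => (sort_index [tuple i; j; p.1; p.2] == s)%:R *
  ((sort_index [tuple i; j; p.1; p.2] == s)%:R * (u 0 p.1 * w 0 p.2)))) => [|p _]; last first.
  by case: (_ == _); rewrite ?mul1r// !mul0r.
apply: le_trans (cauchy_schwarz _ _) _; apply: ler_pM.
- by apply: sumr_ge0 => p _; exact: sqr_ge0.
- by apply: sumr_ge0 => p _; exact: sqr_ge0.
- rewrite nb_permE sum_tuple4 (bigD1 i)//= (bigD1 j)//= pair_bigA/=.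
  rewrite -addrA (eq_bigr (fun p : I * I => (sort_index [tuple i; j; p.1; p.2] == s)%:R)); last first.
    by move=> p _; case: (_ == _); rewrite ?expr1n ?expr0n.
  by rewrite lerDl addr_ge0//; do ! (apply: sumr_ge0 => ? _).
- apply: ler_sum => p _; case: (_ == _) => /=; first by rewrite !mul1r exprMn.
  by rewrite !mul0r expr0n.
Qed.

(** Column by column: the normalization of the coordinates turns the squared
    norm of a column into a Frobenius norm over all multi-indices, which
    [lift_sym4_norm] and [frob_sq_class_contract] bound.  Every multi-index
    belongs to exactly one class, so the columns add up to the sum of
    u_k^2 w_l^2 over i, j, k, l. *)
Lemma perturb_coef_hs u w : unit_sphere u ->
  \sum_s \sum_s' perturb_coef u w s s' ^+ 2 <= 341 * (n%:R ^+ 2 * norm2 w ^+ 2).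
Proof.
move=> u1; rewrite exchange_big/=.
have col s' : \sum_s perturb_coef u w s s' ^+ 2 <= 341 *
   \sum_i \sum_j \sum_k \sum_l (sort_index [tuple i; j; k; l] == s')%:R * (u 0 k ^+ 2 * w 0 l ^+ 2).
  pose f t := eval_tuple4 (lift_sym4 u (class_contract u w s')) t.
  have E1 : \sum_s perturb_coef u w s s' ^+ 2 =
      (nb_perm (sval s'))%:R^-1 * \sum_(s : S) (nb_perm (sval s))%:R * f (sval s) ^+ 2.
    rewrite mulr_sumr; apply: eq_bigr => s _.
    rewrite /perturb_coef !exprMn exprVn !gote_sd2 -/(f _).
    by field; rewrite !gt_eqF// nb_perm_gt0.
  have E2 : \sum_(s : S) (nb_perm (sval s))%:R * f (sval s) ^+ 2 = \sum_t f t ^+ 2.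
    rewrite (eq_bigr (fun s : S => \sum_t (sort_index t == s)%:R * f t ^+ 2)) => [|s _]; last first.
      rewrite nb_permE mulr_suml; apply: eq_bigr => t _.
      case: eqP => [<-|_]; last by rewrite !mul0r.
      congr (_ * _ ^+ 2).
      by apply: lift_sym4_perm_eq (perm_sort_index t); exact: class_contract_sym.
    rewrite exchange_big/=; apply: eq_bigr => t _.
    rewrite (bigD1 (sort_index t))//= eqxx mul1r big1 ?addr0// => s ns.
    by rewrite eq_sym (negbTE ns) mul0r.
  rewrite E1 E2 ler_pdivrMl ?nb_perm_gt0// sum_tuple4.
  apply: le_trans (lift_sym4_norm _ u1) _.
  by rewrite mulrCA ler_wpM2l ?ler0n//; exact: frob_sq_class_contract.
apply: le_trans (ler_sum _ (fun s' _ => col s')) _.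
rewrite -mulr_sumr; apply: ler_wpM2l; first exact: ler0n.
rewrite exchange_big/= (eq_bigr (fun i => n%:R * norm2 w ^+ 2)) => [|i _].
  by rewrite sumr_const card_ord -[X in X <= _]mulr_natl mulrA expr2.
rewrite exchange_big/= (eq_bigr (fun i => norm2 w ^+ 2)) => [|j _].
  by rewrite sumr_const card_ord -[LHS]mulr_natl.
rewrite exchange_big/= (eq_bigr (fun k => u 0 k ^+ 2 * norm2 w ^+ 2)) => [|k _].
  by rewrite -mulr_suml (unit_sphere_sum u1) mul1r.
rewrite exchange_big/= /norm2 sqr_sqrtr ?sumr_ge0//; last by move=> *; exact: sqr_ge0.
rewrite mulr_sumr; apply: eq_bigr => l _.
rewrite (bigD1 (sort_index [tuple i; j; k; l]))//= (eqxx (sort_index _)) mul1r big1 ?addr0// => s ns.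
by rewrite eq_sym (negbTE ns) mul0r.
Qed.

Local Notation K := #|S|.
Local Notation vec := (K.-tuple (measurableTypeR R)).

Definition perturb_mx u w (a b : 'I_K) : R := perturb_coef u w (enum_val a) (enum_val b).

Lemma sum_enum (f : S -> R) : \sum_(a < K) f (enum_val a) = \sum_s f s.
Proof. by rewrite -big_enum_val. Qed.

Lemma hs_sq_perturb_mx u w : unit_sphere u -> hs_sq (perturb_mx u w) <= (19 * n%:R * norm2 w) ^+ 2.
Proof.
move=> u1; apply: le_trans (_ : 341 * (n%:R ^+ 2 * norm2 w ^+ 2) <= _).
  apply: le_trans (perturb_coef_hs w u1).
  rewrite /hs_sq /perturb_mx -(sum_enum (fun s => \sum_s' perturb_coef u w s s' ^+ 2)).
  apply: ler_sum => a _.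
  by rewrite -(sum_enum (fun s' => perturb_coef u w (enum_val a) s' ^+ 2)).
have : 0 <= n%:R ^+ 2 * norm2 w ^+ 2 by rewrite mulr_ge0 ?sqr_ge0.
rewrite !exprMn; lra.
Qed.

(** The symmetric tensor with normalized coordinates x. *)
Definition tensor_of (x : vec) (t : 4.-tuple I) : R :=
  gote_sd (sval (sort_index t)) * tnth x (enum_rank (sort_index t)).

Lemma tensor_of_add_lin u w x t : tensor_of (add_lin (perturb_mx u w) x) t =
  tensor_of x t + eval_tuple4 (lift_sym4 u (tensor_contract (tensor_of x) u w)) t.
Proof.
pose z (s : S) := gote_sd (sval s) * tnth x (enum_rank s).
have mE : fun_of_matrix (tensor_contract (tensor_of x) u w) =
    (fun i j => \sum_s z s * class_contract u w s i j).
  apply/funext => i; apply/funext => j; rewrite mxE.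
  under [RHS]eq_bigr do rewrite mulr_sumr; rewrite [RHS]exchange_big/=; apply: eq_bigr => k _.
  under [RHS]eq_bigr do rewrite mulr_sumr; rewrite [RHS]exchange_big/=; apply: eq_bigr => l _.
  rewrite (bigD1 (sort_index [tuple i; j; k; l]))//= (eqxx (sort_index _)) mul1r mulrA big1 ?addr0// => s ns.
  by rewrite eq_sym (negbTE ns) !mul0r mulr0.
rewrite mE.
have ms i j : \sum_s z s * class_contract u w s i j = \sum_s z s * class_contract u w s j i.
  by apply: eq_bigr => s _; rewrite class_contract_sym.
rewrite -(lift_sym4_perm_eq _ ms (perm_sort_index t)).
rewrite /tensor_of tnth_mktuple mulrDr; congr (_ + _).
rewrite /eval_tuple4 lift_sym4_sum mulr_sumr.
rewrite -(sum_enum (fun s => z s * lift_sym4 u (class_contract u w s) _ _ _ _)).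
apply: eq_bigr => b _.
rewrite /perturb_mx /perturb_coef enum_rankK /z enum_valK /eval_tuple4.
have s0 : 0 < gote_sd (sval (sort_index t)) by exact: gote_sd_gt0.
by field; rewrite gt_eqF.
Qed.

Definition contract_coords u (x : vec) : #|upper_index n|.-tuple (measurableTypeR R) :=
  upper_entries (tensor_contract (tensor_of x) u u).

Lemma measurable_contract_coords u : measurable_fun setT (contract_coords u).
Proof.
apply/measurable_fun_tnthP => k.
rewrite (_ : _ \o _ = fun x => \sum_(a < n) \sum_(b < n)
  tensor_of x [tuple (sval (enum_val k)).1; (sval (enum_val k)).2; a; b]
  * u 0 a * u 0 b); last first.
  by apply/funext => w; rewrite /= tnth_mktuple mxE.
apply: measurable_sum => a; apply: measurable_sum => b.
apply: measurable_funM; last exact: measurable_cst.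
apply: measurable_funM; last exact: measurable_cst.
apply: measurable_funM; first exact: measurable_cst.
exact: measurable_tnth.
Qed.

Lemma tensor_contract_add_lin u v x : unit_sphere u ->
  tensor_contract (tensor_of (add_lin (perturb_mx u (v - u)) x)) u u =
  tensor_contract (tensor_of x) u v.
Proof.
move=> u1; apply/matrixP => i j.
pose m := tensor_contract (tensor_of x) u (v - u).
rewrite mxE (eq_bigr (fun k => \sum_l tensor_of x [tuple i; j; k; l] * u 0 k * u 0 l
   + \sum_l lift_sym4 u m i j k l * u 0 k * u 0 l)) => [|k _]; last first.
  by rewrite -big_split/=; apply: eq_bigr => l _; rewrite tensor_of_add_lin -/m /eval_tuple4/= !mulrDl.
rewrite big_split/= (lift_sym4_contract _ i j u1) !mxE -big_split/=; apply: eq_bigr => k _.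
by rewrite -big_split/=; apply: eq_bigr => l _; rewrite !mxE; ring.
Qed.

End Final.

Theorem theorem2p5 (R : realType) :
  exists C : R, 0 < C /\
    forall (n : nat), (1 <= n)%N ->
    forall (d : measure_display) (T : measurableType d) (P : probability T R)
      (G : 4.-tuple 'I_n -> {RV P >-> R}), is_GOTE4 G ->
    forall u v : 'rV[R]_n, unit_sphere u -> unit_sphere v ->
      (d_TV (contraction_law G u v) (contraction_law G u u)
        <= (C * n%:R * norm2 (u - v))%:E)%E.
Proof.
exists 95; split => // n n0 d T P G GG u v u1 _.
have nN : norm2 (v - u) = norm2 (u - v).
  by congr Num.sqrt; apply: eq_bigr => i _; rewrite !mxE -sqrrN opprB.
apply: ge_ereal_sup => _ [A mA <-].
(* The total variation bound needs a positive parameter, so u = v is treated apart. *)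
have [uv|uv] := eqVneq u v.
  rewrite uv subee; last exact: fin_num_measure.
  by rewrite abse0 lee_fin mulr_ge0// ?sqrtr_ge0// mulr_ge0.
have nz : 0 < norm2 (u - v).
  rewrite sqrtr_gt0 lt_neqAle sumr_ge0 ?andbT => [|i _]; last exact: sqr_ge0.
  apply: contra uv => /eqP/esym/eqP; rewrite psumr_eq0 => [/allP h|i _]; last exact: sqr_ge0.
  apply/eqP/rowP => i; have := h i; rewrite mem_index_enum => /(_ isT).
  by rewrite sqrf_eq0 !mxE subr_eq0 => /eqP.
have contrE w' x : Defs.contraction G u w' x =
    upper_entries (tensor_contract (tensor_of (gote_coords G x)) u w').
  rewrite /Defs.contraction; congr upper_entries; apply/matrixP => i j; rewrite !mxE.
  apply: eq_bigr => k _; apply: eq_bigr => l _; congr (_ * _ * _).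
  rewrite /tensor_of tnth_mktuple enum_rankK.
  case: GG => symG _ _; rewrite (symG _ _ x (perm_sort_index [tuple i; j; k; l])).
  by rewrite mulrC divfK// gt_eqF// gote_sd_gt0.
have mB : measurable (contract_coords u @^-1` A).
  by rewrite -[X in measurable X]setTI; exact: measurable_contract_coords.
have mB' : measurable (add_lin (perturb_mx u (v - u)) @^-1` (contract_coords u @^-1` A)).
  by rewrite -[X in measurable X]setTI; exact: measurable_add_lin.
have -> : contraction_law G u v A = gauss _ (add_lin (perturb_mx u (v - u)) @^-1` (contract_coords u @^-1` A)).
  rewrite -(gote_coords_law GG mB'); congr (P _).
  apply/seteqP; split => x /=; rewrite contrE /contract_coords tensor_contract_add_lin//.
have -> : contraction_law G u u A = gauss _ (contract_coords u @^-1` A).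
  rewrite -(gote_coords_law GG mB); congr (P _).
  by apply/seteqP; split => x /=; rewrite contrE.
have -> : 95 * n%:R * norm2 (u - v) = 5 * (19 * n%:R * norm2 (v - u)) :> R.
  by rewrite nN; ring.
apply: gauss_add_lin_TV => //; last exact: hs_sq_perturb_mx.
by rewrite nN !mulr_gt0// ltr0n.
Qed.
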